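(* Let $n\ge 2$ and let $\Gamma=\operatorname{SL}_n(\mathbb{Z})$ act on $\mathfrak{sl}_n(\mathbb{Z})\cong\mathbb{Z}^{n^2-1}$ by conjugation, $\gamma\cdot v=\gamma v\gamma^{-1}$. Let $\mathcal{A}=\{c_p\;:\;p(t)=a_0+a_1t+\dots+a_{n-1}t^{n-1}+t^n\in\mathbb{Z}[t],\ a_{n-1}=0\}$ be the set of companion matrices of monic integer polynomials of degree $n$ whose $t^{n-1}$-coefficient vanishes (so that $c_p$ has trace $0$). Then: (1) the conjugation action of $\Gamma$ on $\mathfrak{sl}_n(\mathbb{Z})$ has uniformly virtually recurrent orbits across $\mathcal{A}$; (2) the characteristic polynomial map $\mathfrak{sl}_n(\mathbb{Z})\to\mathbb{Z}[t]$, $A\mapsto\det(tI-A)$, has uniformly virtually recurrent level sets; (3) the quadratic form $F:\mathbb{Z}^3\to\mathbb{Z}$, $F(x,y,z)=xy-z^2$, has uniformly virtually recurrent level sets.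
   Context: Companion matrix: for $p(t)=a_0+a_1t+\dots+a_{n-1}t^{n-1}+t^n$, $c_p$ is the $n\times n$ matrix with entries $1$ on the subdiagonal (positions $(i+1,i)$), last column $(-a_0,-a_1,\dots,-a_{n-1})^T$, and all other entries $0$. $\mathfrak{sl}_n(\mathbb{Z})$ is the additive group of $n\times n$ integer matrices of trace $0$, identified with $\mathbb{Z}^{n^2-1}$ via a fixed basis. A measure preserving action $T:\mathbb{Z}^d\curvearrowright(X,\mu)$ is an action of $\mathbb{Z}^d$ on a probability space by measure preserving maps $T^v$, $v\in\mathbb{Z}^d$; sets $B\subset X$ are measurable. Uniformly virtually recurrent orbits across $A$: a semigroup action $\Gamma\curvearrowright\mathbb{Z}^d$ has this property for $A\subset\mathbb{Z}^d$ if for each $\epsilon>0$ there is a positive integer $k_0(\epsilon)$ such that for every measure preserving action $T:\mathbb{Z}^d\curvearrowright(X,\mu)$ and every $B\subset X$ with $\mu(B)>\epsilon$ there exists $0<k\le k_0(\epsilon)$ such that for each $v\in A$ there is $\gamma\in\Gamma$ with $\mu(B\cap T^{k\gamma v}B)>0$. Uniformly virtually recurrent level sets: a function $F:\mathbb{Z}^d\to\mathcal{S}$ (any set $\mathcal{S}$) has this property if for all $\epsilon>0$ there is a positive integer $k=k(\epsilon)$ such that for every measure preserving action $T:\mathbb{Z}^d\curvearrowright(X,\mu)$ and $B\subset X$ with $\mu(B)>\epsilon$, for every $s\in F(k\mathbb{Z}^d)$ there exists $v\in\mathbb{Z}^d$ with $F(v)=s$ and $\mu(B\cap T^vB)>0$.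 *)

(* Defs.v *)
From HB Require Import structures.
From mathcomp Require Import all_boot all_order all_algebra.
From mathcomp Require Import all_classical all_reals all_analysis.
Set Implicit Arguments. Unset Strict Implicit. Unset Printing Implicit Defensive.
Import Order.TTheory GRing.Theory Num.Theory.
Local Open Scope classical_set_scope.
Local Open Scope ring_scope.

(* A measure preserving action of the additive group S (a subgroup of the
   zmodType V, given as a set) on the probability space (X, mu).
   The maps T v for v outside S are irrelevant. *)
Definition mp_action (R : realType) (V : zmodType) (S : set V)
  (d : measure_display) (X : measurableType d) (mu : probability X R)
  (T : V -> X -> X) : Prop :=
  [/\ (forall x, T 0 x = x),
      (forall u v, S u -> S v -> forall x, T (u + v) x = T u (T v x)),
      (forall v, S v -> measurable_fun setT (T v)) &
      (forall v, S v -> forall A, measurable A -> mu (T v @^-1` A) = mu A)].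

Definition uvr_orbits (R : realType) (V : zmodType) (S : set V)
  (G : Type) (Gam : set G) (act : G -> V -> V) (A : set V) : Prop :=
  forall eps : R, 0 < eps -> exists k0 : nat, (0 < k0)%N /\
    forall (d : measure_display) (X : measurableType d) (mu : probability X R)
      (T : V -> X -> X), mp_action S mu T ->
    forall B : set X, measurable B -> (eps%:E < mu B)%E ->
    exists k : nat, (0 < k <= k0)%N /\
      forall v, A v -> exists g, Gam g /\
        (0 < mu (B `&` (T ((act g v) *+ k)%R @` B)))%E.

Definition uvr_level_sets (R : realType) (V : zmodType) (S : set V)
  (Sc : Type) (F : V -> Sc) : Prop :=
  forall eps : R, 0 < eps -> exists k : nat, (0 < k)%N /\
    forall (d : measure_display) (X : measurableType d) (mu : probability X R)
      (T : V -> X -> X), mp_action S mu T ->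
    forall B : set X, measurable B -> (eps%:E < mu B)%E ->
    forall w, S w -> exists v, S v /\ F v = F (w *+ k)%R /\
      (0 < mu (B `&` (T v @` B)))%E.

Definition sl (n : nat) : set 'M[int]_n := [set v | \tr v = 0].

Definition SL (n : nat) : set 'M[int]_n := [set g | \det g = 1].

Definition conj_act (n : nat) (g v : 'M[int]_n) : 'M[int]_n :=
  g *m v *m invmx g.

Definition companion (n : nat) (p : {poly int}) : 'M[int]_n :=
  \matrix_(i < n, j < n)
    (if (j : nat) == n.-1 then - p`_i else ((i : nat) == j.+1)%:R).

Definition companion_set (n : nat) : set 'M[int]_n :=
  [set c | exists p : {poly int},
     [/\ p \is monic, size p = n.+1, p`_n.-1 = 0 & c = companion n p]].

Definition quadF (v : 'rV[int]_3) : int :=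
  v ord0 (@Ordinal 3 0 isT) * v ord0 (@Ordinal 3 1 isT)
  - v ord0 (@Ordinal 3 2 isT) ^+ 2.

(* Main.v *)
Require Import Defs.
From HB Require Import structures.
From mathcomp Require Import all_boot all_order all_algebra.
From mathcomp Require Import all_classical all_reals all_analysis.
From mathcomp Require Import measurable_realfun.
From mathcomp Require Import ring lra zify.
Import Order.TTheory GRing.Theory Num.Theory.
Local Open Scope classical_set_scope.
Local Open Scope ring_scope.
Set Implicit Arguments. Unset Strict Implicit. Unset Printing Implicit Defensive.

(** Write [U^v] for the Koopman representation of Z^d on bounded measurable
functions and [xi = 1_B].  Put [E = E_01].  A companion matrix [v] has entry
[v_10 = 1], so for [g] in SL_n(Z) the conjugates of [v] by [g (1 + x E)] form a
quadratic walk [q + x l + x^2 w] whose leading coefficient [w = - g E g^-1]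
does not depend on [v].  By van der Corput, the averages of [U^(K (q + x l +
x^2 w)) eta] are small as soon as the averages of [eta] along the multiples of
[K M w] are, where [M = 2 h!] depends only on the wanted precision.

Choose many [w]'s in general position: any [n^2 + 1] of them span a lattice
containing [L sl_n(Z)].  If [eta = xi - zeta] with [zeta] an average of [xi]
over [K M L sl_n(Z)], then averaging [eta] along any [n^2 + 1] of the [w]'s
kills it; by a Cauchy-Schwarz pigeonhole argument ([doubling]) averaging along
a single well-chosen [w] already makes it small.  Finally, [K] is picked among
the powers of [M L] so that [zeta] is almost [K sl_n(Z)]-invariant: the
norms of the almost minimal averages of [xi] over [(M L)^i sl_n(Z)] increase
with [i] and are bounded, so they are almost equal for two consecutive
[i]'s.  Then [<xi, U^(K o) xi>] is close, on average, to [<xi, zeta> >=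
mu(B)^2].  The level set statements follow since every traceless matrix has
the characteristic polynomial of a companion matrix, and since [x y - z^2] is
the determinant on sl_2. *)

Lemma half_scaleD (R : realType) (H : lmodType R) (x : H) : 2^-1 *: (x + x) = x.
Proof. by rewrite -mulr2n -[x *+ 2]scaler_nat scalerA mulVf ?scale1r ?pnatr_eq0. Qed.

(** * Averages in unitary representations *)

(** [ip] is positive semidefinite and [H] a bare vector space, so that bounded measurable functions
    can be used directly, not as classes modulo null sets; all estimates are finitary and no limit
    is taken. *)
Record unitary_rep (R : realType) (V : zmodType) (H : lmodType R)
    (ip : H -> H -> R) (U : V -> H -> H) : Prop := UnitaryRep {
  ipC : forall x y, ip x y = ip y x;
  ipPl : forall a x y z, ip (a *: x + y) z = a * ip x z + ip y z;
  ip_ge0 : forall x, 0 <= ip x x;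
  repP : forall v a x y, U v (a *: x + y) = a *: U v x + U v y;
  rep0 : forall x, U 0 x = x;
  repD : forall u v x, U (u + v) x = U u (U v x);
  rep_iso : forall v x y, ip (U v x) (U v y) = ip x y }.

Lemma sumr_ord_const (R : pzRingType) (a : R) n : \sum_(i < n) a = n%:R * a.
Proof. by rewrite sumr_const card_ord mulr_natl. Qed.

(** Parameters of [doubling], dictated by [pair_correlation]: more than [32 / c ^+ 2] vectors with
    lower bound [c] yield a pair with lower bound [c ^+ 2 / 8]. [dbl_size] counts the directions
    needed at the start. *)
Fixpoint dbl_bound (R : realType) (c : R) (j : nat) : R :=
  if j is j'.+1 then dbl_bound c j' ^+ 2 / 8 else c.

Fixpoint dbl_size (R : realType) (c : R) (j : nat) : nat :=
  if j is j'.+1 then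
    (dbl_size c j' * (Num.truncn (32 / dbl_bound c j' ^+ 2)).+1)%N
  else 1.

Lemma dbl_bound_gt0 (R : realType) (c : R) j : 0 < c -> 0 < dbl_bound c j.
Proof. by move=> c0; elim: j => //= j IH; rewrite divr_gt0 ?exprn_gt0 ?ltr0n. Qed.

Lemma subseq_blocks (T : eqType) k b b' (s J J' : seq T) : (b < b')%N ->
  subseq J (take k (drop (b * k) s)) -> subseq J' (take k (drop (b' * k) s)) ->
  subseq (J ++ J') s.
Proof.
move=> bb hJ hJ'; rewrite -(cat_take_drop (b' * k) s); apply: cat_subseq.
  apply: subseq_trans hJ _; rewrite take_drop -mulSn.
  rewrite -(@take_takel _ _ (b' * k)) ?leq_mul2r ?bb ?orbT //.
  by apply: subseq_trans (drop_subseq _ _) (take_subseq _ _).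
by apply: subseq_trans hJ' (take_subseq _ _).
Qed.

Section Averages.
Variables (R : realType) (V : zmodType) (H : lmodType R).
Variables (ip : H -> H -> R) (U : V -> H -> H).
Hypothesis rep : unitary_rep ip U.

(** * The seminorm of the form [ip] *)

Lemma ipDl x y z : ip (x + y) z = ip x z + ip y z.
Proof. by have := ipPl rep 1 x y z; rewrite scale1r mul1r. Qed.

Lemma ip0l z : ip 0 z = 0.
Proof. by apply: (addrI (ip 0 z)); rewrite -ipDl !addr0. Qed.

Lemma ipZl a x z : ip (a *: x) z = a * ip x z.
Proof. by have := ipPl rep a x 0 z; rewrite !addr0 ip0l addr0. Qed.

Lemma ipDr x y z : ip z (x + y) = ip z x + ip z y.
Proof. by rewrite !(ipC rep z) ipDl. Qed.

Lemma ipZr a x z : ip z (a *: x) = a * ip z x.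
Proof. by rewrite !(ipC rep z) ipZl. Qed.

Lemma ipNl x z : ip (- x) z = - ip x z.
Proof. by rewrite -scaleN1r ipZl mulN1r. Qed.

Lemma ipNr x z : ip z (- x) = - ip z x.
Proof. by rewrite !(ipC rep z) ipNl. Qed.

Lemma ip_suml I (r : seq I) (F : I -> H) z :
  ip (\sum_(i <- r) F i) z = \sum_(i <- r) ip (F i) z.
Proof.
apply: (big_morph (ip^~ z)) => [x y|]; [exact: ipDl | exact: ip0l].
Qed.

Lemma ip_sumr I (r : seq I) (F : I -> H) z :
  ip z (\sum_(i <- r) F i) = \sum_(i <- r) ip z (F i).
Proof. by rewrite (ipC rep) ip_suml; apply: eq_bigr => i _; rewrite (ipC rep). Qed.

Lemma ip_cauchy_schwarz x y : (ip x y) ^+ 2 <= ip x x * ip y y.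
Proof.
have hx := ip_ge0 rep x; have hy := ip_ge0 rep y.
have E a b : ip (a *: x - b *: y) (a *: x - b *: y) =
    a ^+ 2 * ip x x - a * b * ip x y *+ 2 + b ^+ 2 * ip y y.
  rewrite !(ipDl, ipDr, ipNl, ipNr, ipZl, ipZr) (ipC rep y x); ring.
(* The first two vectors settle the cases [ip y y > 0] and [ip x x > 0]; if both vanish, the form at
   [x - y] and [x + y] forces [ip x y = 0]. *)
have h1 := ip_ge0 rep (ip y y *: x - ip x y *: y).
have h2 := ip_ge0 rep (ip x y *: x - ip x x *: y).
have h3 := ip_ge0 rep (1 *: x - 1 *: y).
have h4 := ip_ge0 rep (1 *: x - (-1) *: y).
rewrite !E in h1 h2 h3 h4.
have {}h1 : 0 <= ip y y * (ip x x * ip y y - ip x y ^+ 2) by nra.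
have {}h2 : 0 <= ip x x * (ip x x * ip y y - ip x y ^+ 2) by nra.
have [y0|y0] := eqVneq (ip y y) 0; last first.
  have y1 : 0 < ip y y by rewrite lt_def y0.
  by rewrite pmulr_rge0 // subr_ge0 in h1.
have [x0|x0] := eqVneq (ip x x) 0; last first.
  have x1 : 0 < ip x x by rewrite lt_def x0.
  by rewrite pmulr_rge0 // subr_ge0 in h2.
have -> : ip x y = 0 by lra.
by rewrite x0 y0 mul0r expr0n.
Qed.

Definition nm x := Num.sqrt (ip x x).

Lemma nm_ge0 x : 0 <= nm x. Proof. exact: sqrtr_ge0. Qed.

Lemma nm_sqr x : nm x ^+ 2 = ip x x.
Proof. by rewrite sqr_sqrtr // (ip_ge0 rep). Qed.

Lemma ip_le_nm x y : `|ip x y| <= nm x * nm y.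
Proof.
rewrite -(@ler_pXn2r _ 2) ?nnegrE ?mulr_ge0 ?nm_ge0 ?normr_ge0 //.
by rewrite exprMn !nm_sqr real_normK ?num_real // ip_cauchy_schwarz.
Qed.

Lemma nm_le x c : 0 <= c -> (nm x <= c) = (ip x x <= c ^+ 2).
Proof.
by move=> c0; rewrite -nm_sqr ler_pXn2r ?nnegrE ?nm_ge0.
Qed.

Lemma nmD x y : nm (x + y) <= nm x + nm y.
Proof.
rewrite nm_le ?addr_ge0 ?nm_ge0 //.
rewrite ipDl !ipDr (ipC rep y x) sqrrD !nm_sqr.
have := ler_norm (ip x y); have := ip_le_nm x y; lra.
Qed.

Lemma nmZ a x : nm (a *: x) = `|a| * nm x.
Proof. by rewrite /nm ipZl ipZr mulrA -expr2 sqrtrM ?sqr_ge0 // sqrtr_sqr. Qed.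

Lemma nmN x : nm (- x) = nm x.
Proof. by rewrite -scaleN1r nmZ normrN normr1 mul1r. Qed.

Lemma nmB x y : nm (x - y) <= nm x + nm y.
Proof. by rewrite -(nmN y) nmD. Qed.

Lemma nm0 : nm 0 = 0.
Proof. by rewrite /nm ip0l sqrtr0. Qed.

Lemma nm_sum I (r : seq I) (F : I -> H) :
  nm (\sum_(i <- r) F i) <= \sum_(i <- r) nm (F i).
Proof.
elim/big_rec2: _ => [|i y z _ yz]; first by rewrite nm0.
by rewrite (le_trans (nmD _ _)) // lerD2l.
Qed.

Lemma nm_rep v x : nm (U v x) = nm x.
Proof. by rewrite /nm (rep_iso rep). Qed.

Lemma rep_add v x y : U v (x + y) = U v x + U v y.
Proof. by have := repP rep v 1 x y; rewrite !scale1r. Qed.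

Lemma rep_zero v : U v 0 = 0.
Proof. by apply: (addrI (U v 0)); rewrite -rep_add !addr0. Qed.

Lemma rep_scale v a x : U v (a *: x) = a *: U v x.
Proof. by have := repP rep v a x 0; rewrite !addr0 rep_zero addr0. Qed.

Lemma rep_opp v x : U v (- x) = - U v x.
Proof. by rewrite -scaleN1r rep_scale scaleN1r. Qed.

Lemma rep_sum v I (r : seq I) (F : I -> H) :
  U v (\sum_(i <- r) F i) = \sum_(i <- r) U v (F i).
Proof.
by apply: (big_morph (U v)) => [x y|]; [exact: rep_add | exact: rep_zero].
Qed.

Lemma rep_comm u v x : U u (U v x) = U v (U u x).
Proof. by rewrite -!(repD rep) addrC. Qed.

Lemma rep_adj v x y : ip (U v x) y = ip x (U (- v) y).
Proof. by rewrite -(rep_iso rep v x) -(repD rep) subrr (rep0 rep). Qed.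

(** * Finite averages, and averages along multiples of a vector *)

Definition avg (N : nat) (y : nat -> H) : H := N%:R^-1 *: \sum_(i < N) y i.

Lemma eq_avg N y z : y =1 z -> avg N y = avg N z.
Proof. by move=> yz; rewrite /avg; under eq_bigr do rewrite yz. Qed.

Lemma avgD N y z : avg N (fun i => y i + z i) = avg N y + avg N z.
Proof. by rewrite /avg big_split scalerDr. Qed.

Lemma avgZ N a y : avg N (fun i => a *: y i) = a *: avg N y.
Proof. by rewrite /avg -scaler_sumr !scalerA mulrC. Qed.

Lemma avgB N y z : avg N (fun i => y i - z i) = avg N y - avg N z.
Proof. by rewrite avgD; congr (_ + _); rewrite /avg sumrN scalerN. Qed.

Lemma avg_cst N x : (0 < N)%N -> avg N (fun=> x) = x.
Proof.
move=> N0; rewrite /avg sumr_const card_ord -[x *+ N]scaler_nat scalerA mulVf ?scale1r //.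
by rewrite pnatr_eq0 -lt0n.
Qed.

Lemma rep_avg v N y : U v (avg N y) = avg N (fun i => U v (y i)).
Proof. by rewrite /avg rep_scale rep_sum. Qed.

Lemma ip_avgl N y z : ip (avg N y) z = N%:R^-1 * \sum_(i < N) ip (y i) z.
Proof. by rewrite /avg ipZl ip_suml. Qed.

Lemma ip_avgr N y z : ip z (avg N y) = N%:R^-1 * \sum_(i < N) ip z (y i).
Proof. by rewrite /avg ipZr ip_sumr. Qed.

Lemma nm_avg N y c : (0 < N)%N -> (forall i, (i < N)%N -> nm (y i) <= c) ->
  nm (avg N y) <= c.
Proof.
move=> N0 yc; have NR : 0 < N%:R :> R by rewrite ltr0n.
rewrite /avg nmZ ger0_norm ?invr_ge0 ?ler0n // ler_pdivrMl //.
rewrite (le_trans (nm_sum _ _)) //.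
rewrite (le_trans (ler_sum _ (fun (i : 'I_N) _ => yc i (ltn_ord i)))) //.
by rewrite sumr_ord_const.
Qed.

(** Convexity of the squared norm: with [a] the average, sum
    [2 ip (y i) a <= ip (y i) (y i) + ip a a] over [i]; the left sides add up to [2 N ip a a]. *)
Lemma ip_avg_le N y : (0 < N)%N ->
  ip (avg N y) (avg N y) <= N%:R^-1 * \sum_(i < N) ip (y i) (y i).
Proof.
move=> N0; have NR : 0 < N%:R :> R by rewrite ltr0n.
rewrite ler_pdivlMl //; set a := avg N y.
have E : N%:R * ip a a = \sum_(i < N) ip (y i) a.
  by rewrite {1}/a ip_avgl mulrA divff ?mul1r // pnatr_eq0 -lt0n.
have : \sum_(i < N) ip (y i) a <= \sum_(i < N) (ip (y i) (y i) + ip a a) / 2.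
  apply: ler_sum => i _; have := ip_ge0 rep (y i - a).
  rewrite ipDl !ipDr !ipNl !ipNr (ipC rep a (y i)); lra.
rewrite -mulr_suml big_split /= sumr_const card_ord -E -mulr_natl; lra.
Qed.

Lemma avg_telescope N y :
  avg N y - avg N (fun i => y i.+1) = N%:R^-1 *: (y 0%N - y N).
Proof.
rewrite /avg -scalerBr -sumrB; congr (_ *: _); rewrite -[RHS]opprB.
rewrite -(telescope_sumr _ (leq0n N)) big_mkord -sumrN.
by apply: eq_bigr => i _; rewrite opprB.
Qed.

(** Each unit shift exchanges a single term of the sum, at a cost of [2 c / N]. *)
Lemma nm_avg_shift N y c h : (0 < N)%N -> (forall i, nm (y i) <= c) ->
  nm (avg N y - avg N (fun i => y (i + h)%N)) <= 2 * h%:R * c / N%:R.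
Proof.
move=> N0 yc; have NR : 0 < N%:R :> R by rewrite ltr0n.
elim: h => [|h IH].
  have -> : avg N (fun i => y (i + 0)%N) = avg N y.
    by apply: eq_avg => i; rewrite addn0.
  by rewrite subrr nm0 mulr0 !mul0r.
have -> : avg N y - avg N (fun i => y (i + h.+1)%N) =
    (avg N y - avg N (fun i => y (i + h)%N)) + N%:R^-1 *: (y h - y (N + h)%N).
  rewrite -(avg_telescope N (fun i => y (i + h)%N)) addrA subrK.
  by congr (_ - _); apply: eq_avg => i; rewrite addSnnS.
have -> : 2 * h.+1%:R * c / N%:R = 2 * h%:R * c / N%:R + N%:R^-1 * (c + c).
  rewrite -[h.+1]addn1 natrD; ring.
rewrite (le_trans (nmD _ _)) // lerD //.
rewrite nmZ ger0_norm ?invr_ge0 ?ler0n // ler_pM2l ?invr_gt0 //.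
by rewrite (le_trans (nmB _ _)) // lerD.
Qed.

Definition mav (w : V) (N : nat) (x : H) : H := avg N (fun i => U (w *+ i) x).

Lemma mavB w N x y : mav w N (x - y) = mav w N x - mav w N y.
Proof. by rewrite /mav -avgB; apply: eq_avg => i; rewrite rep_add rep_opp. Qed.

Lemma mavD w N x y : mav w N (x + y) = mav w N x + mav w N y.
Proof. by rewrite /mav -avgD; apply: eq_avg => i; rewrite rep_add. Qed.

Lemma mavZ w N a x : mav w N (a *: x) = a *: mav w N x.
Proof. by rewrite /mav -avgZ; apply: eq_avg => i; rewrite rep_scale. Qed.

Lemma mav0 w N : mav w N 0 = 0.
Proof. by have := mavZ w N 0 0; rewrite !scale0r. Qed.

Lemma mavN w N x : mav w N (- x) = - mav w N x.
Proof. by rewrite -scaleN1r mavZ scaleN1r. Qed.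

Lemma mav_sum w N I (r : seq I) (F : I -> H) :
  mav w N (\sum_(i <- r) F i) = \sum_(i <- r) mav w N (F i).
Proof.
by apply: (big_morph (mav w N)) => [x y|]; [exact: mavD | exact: mav0].
Qed.

Lemma mav_avg w N M y : mav w N (avg M y) = avg M (fun i => mav w N (y i)).
Proof. by rewrite /avg mavZ mav_sum. Qed.

Lemma mav_rep w N v x : mav w N (U v x) = U v (mav w N x).
Proof. by rewrite /mav rep_avg; apply: eq_avg => i; rewrite rep_comm. Qed.

Lemma mavC w N v M x : mav w N (mav v M x) = mav v M (mav w N x).
Proof. by rewrite {2}/mav mav_avg; apply: eq_avg => i; rewrite mav_rep. Qed.

Lemma nm_mav w N x : (0 < N)%N -> nm (mav w N x) <= nm x.
Proof. by move=> N0; apply: nm_avg => // i _; rewrite nm_rep. Qed.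

Lemma mav_adj w N x y : ip (mav w N x) y = ip x (mav (- w) N y).
Proof.
rewrite /mav ip_avgl ip_avgr; congr (_ * _); apply: eq_bigr => i _.
by rewrite rep_adj mulNrn.
Qed.

Lemma nm_mav_sub_rep_nat w N x j : (0 < N)%N ->
  nm (mav w N (x - U (w *+ j) x)) <= 2 * j%:R * nm x / N%:R.
Proof.
move=> N0; rewrite mavB.
have -> : mav w N (U (w *+ j) x) = avg N (fun i => U (w *+ (i + j)) x).
  by apply: eq_avg => i; rewrite -(repD rep) -mulrnDr.
by apply: (nm_avg_shift (y := fun i => U (w *+ i) x)) => // i; rewrite nm_rep.
Qed.

Lemma nm_mav_sub_rep w N x (j : int) : (0 < N)%N ->
  nm (mav w N (x - U (w *~ j) x)) <= 2 * `|j|%N%:R * nm x / N%:R.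
Proof.
move=> N0; case: j => j; first exact: nm_mav_sub_rep_nat.
have E : x = U (w *- j.+1) (U (w *+ j.+1) x).
  by rewrite -(repD rep) addNr (rep0 rep).
rewrite NegzE mulrNz {1}E -rep_opp -rep_add mav_rep nm_rep.
by rewrite -opprB mavN nmN abszN nm_mav_sub_rep_nat.
Qed.

(* A long average along [w] is an average of shifts of averages along [w *+ q],
   up to boundary terms. *)
Lemma nm_mav_coarsen w N q M x : (0 < N)%N -> (0 < M)%N ->
  nm (mav w N x) <= nm (mav (w *+ q) M x) + 2 * (q * M)%:R * nm x / N%:R.
Proof.
move=> N0 M0; have NR : 0 < N%:R :> R by rewrite ltr0n.
rewrite -[mav w N x](subrK (mav w N (mav (w *+ q) M x))) addrC.
rewrite (le_trans (nmD _ _)) // lerD ?nm_mav // -mavB.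
have -> : x - mav (w *+ q) M x = avg M (fun i => x - U (w *+ (q * i)) x).
  by rewrite avgB avg_cst //; congr (_ - _); apply: eq_avg => i; rewrite mulrnA.
rewrite mav_avg; apply: nm_avg => // i iM.
rewrite (le_trans (nm_mav_sub_rep_nat _ _ _ N0)) // ler_pM2r ?invr_gt0 //.
by rewrite ler_wpM2r ?nm_ge0 // ler_pM2l ?ltr0n // ler_nat leq_mul2l ltnW ?orbT.
Qed.

(** The average over the box of combinations of [ws] with coefficients in [[0, N)], taken one
    direction at a time. *)
Definition mavs (ws : seq V) (N : nat) (x : H) : H :=
  foldr (fun w y => mav w N y) x ws.

Lemma mavs_cat ws vs N x : mavs (ws ++ vs) N x = mavs ws N (mavs vs N x).
Proof. by rewrite /mavs foldr_cat. Qed.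

Lemma mavs_mav ws N v M x : mavs ws N (mav v M x) = mav v M (mavs ws N x).
Proof. by elim: ws => //= w ws ->; rewrite mavC. Qed.

Lemma mavsC ws vs N x : mavs ws N (mavs vs N x) = mavs vs N (mavs ws N x).
Proof. by elim: vs => //= v vs IH; rewrite mavs_mav IH. Qed.

Lemma mavs_rep ws N v x : mavs ws N (U v x) = U v (mavs ws N x).
Proof. by elim: ws => //= w ws ->; rewrite mav_rep. Qed.

Lemma mavsD ws N x y : mavs ws N (x + y) = mavs ws N x + mavs ws N y.
Proof. by elim: ws => //= w ws ->; rewrite mavD. Qed.

Lemma mavsZ ws N a x : mavs ws N (a *: x) = a *: mavs ws N x.
Proof. by elim: ws => //= w ws ->; rewrite mavZ. Qed.

Lemma nm_mavs ws N x : (0 < N)%N -> nm (mavs ws N x) <= nm x.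
Proof.
by move=> N0; elim: ws => //= w ws; apply: le_trans; apply: nm_mav.
Qed.

Lemma mavs_adj ws N x y :
  ip (mavs ws N x) y = ip x (mavs [seq - w | w <- ws] N y).
Proof. by elim: ws y => //= w ws IH y; rewrite mav_adj IH mavs_mav. Qed.

(** Translating a box by a fixed lattice vector only affects its boundary. The translation is split
    into one multiple of each direction. *)
Lemma nm_mavs_sub_rep ws (c : nat -> int) N x : (0 < N)%N ->
  nm (mavs ws N (x - U (\sum_(i < size ws) ws`_i *~ c i) x)) <=
  2 * (\sum_(i < size ws) `|c i|%N)%:R * nm x / N%:R.
Proof.
move=> N0; have NR : 0 < N%:R :> R by rewrite ltr0n.
elim: ws c => [|w ws IH] c /=.
  by rewrite !big_ord0 (rep0 rep) subrr nm0 mulr0 !mul0r.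
rewrite !big_ord_recl /=; set s := \sum_(i < _) _ *~ _.
have -> : x - U (w *~ c 0%N + s) x = (x - U (w *~ c 0%N) x) + U (w *~ c 0%N) (x - U s x).
  by rewrite (repD rep) rep_add rep_opp addrA subrK.
have DE (a b : nat) : 2 * (a + b)%:R * nm x / N%:R =
    2 * a%:R * nm x / N%:R + 2 * b%:R * nm x / N%:R by rewrite natrD; ring.
rewrite mavsD mavD (le_trans (nmD _ _)) // DE lerD //.
  by rewrite -mavs_mav (le_trans (nm_mavs _ _ N0)) // nm_mav_sub_rep.
rewrite (le_trans (nm_mav _ _ N0)) // mavs_rep nm_rep.
exact: (IH (fun i => c i.+1)).
Qed.

(** * Convex combinations of translations *)

Lemma mulrzMnC (v : V) (k : int) n : v *~ k *+ n = v *+ n *~ k.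
Proof.
case: k => k; first exact: mulrnAC.
by rewrite NegzE !mulrNz mulNrn; congr (- _); exact: mulrnAC.
Qed.

(* Operators in the convex hull of the [U (u *+ K)] (with dyadic weights),
   paired with their adjoints. *)
Inductive avop (K : nat) : (H -> H) -> (H -> H) -> Prop :=
| avop_rep u : avop K (U (u *+ K)) (U (- u *+ K))
| avop_mid P P' Q Q' : avop K P P' -> avop K Q Q' ->
    avop K (fun x => 2^-1 *: (P x + Q x)) (fun x => 2^-1 *: (P' x + Q' x))
| avop_comp P P' Q Q' : avop K P P' -> avop K Q Q' ->
    avop K (fun x => P (Q x)) (fun x => Q' (P' x)).

Lemma avop_sym K P P' : avop K P P' -> avop K P' P.
Proof.
elim=> [u|? ? ? ? _ h1 _ h2|? ? ? ? _ h1 _ h2].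
- by rewrite -{2}(opprK u); apply: avop_rep.
- exact: avop_mid.
- exact: avop_comp.
Qed.

Lemma avop_mul K L P P' : avop (K * L) P P' -> avop K P P'.
Proof.
elim=> [u|? ? ? ? _ h1 _ h2|? ? ? ? _ h1 _ h2].
- by rewrite mulnC !mulrnA mulNrn; apply: avop_rep.
- exact: avop_mid.
- exact: avop_comp.
Qed.

Lemma avop_nm K P P' x : avop K P P' -> nm (P x) <= nm x.
Proof.
move=> h; elim: h x => [u|{}P {}P' Q Q' _ h1 _ h2|{}P {}P' Q Q' _ h1 _ h2] x.
- by rewrite nm_rep.
- rewrite nmZ ger0_norm ?invr_ge0 ?ler0n //.
  have := nmD (P x) (Q x); have := h1 x; have := h2 x; lra.
- exact: le_trans (h1 _) (h2 _).
Qed.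

Lemma avop_adj K P P' x y : avop K P P' -> ip (P x) y = ip x (P' y).
Proof.
move=> h; elim: h x y => [u|{}P {}P' Q Q' _ h1 _ h2|{}P {}P' Q Q' _ h1 _ h2] x y.
- by rewrite rep_adj mulNrn.
- by rewrite ipZl ipZr ipDl ipDr h1 h2.
- by rewrite h1 h2.
Qed.

Lemma avop_fix K P P' e : (forall u, U u e = e) -> avop K P P' -> P e = e.
Proof.
move=> he; elim=> [u|{}P {}P' Q Q' _ -> _ ->|{}P {}P' Q Q' _ h1 _ h2] //.
- exact: half_scaleD.
- by rewrite h2.
Qed.

(** Averages fix invariant vectors, so [ip (P x) e = ip x e] and Cauchy-Schwarz applies. With [e]
    the constant function 1 and [x] the indicator of [B], the lower bound is the square of the
    measure of [B]. *)
Lemma avop_lower K P P' x e : (forall u, U u e = e) -> ip e e = 1 ->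
  avop K P P' -> ip x e ^+ 2 <= ip (P x) (P x).
Proof.
move=> he he1 h; have := ip_cauchy_schwarz (P x) e.
by rewrite he1 mulr1 (avop_adj _ _ h) (avop_fix he (avop_sym h)).
Qed.

Lemma seq_uniform_bound (T : eqType) (s : seq T) (Q : T -> R -> Prop) :
  (forall x a b, a <= b -> Q x a -> Q x b) ->
  (forall x, x \in s -> exists a, Q x a) ->
  exists a, 0 <= a /\ forall x, x \in s -> Q x a.
Proof.
move=> mono; elim: s => [|x s IH] h; first by exists 0.
have [|a [a0 ha]] := IH; first by move=> y ys; apply: h; rewrite inE ys orbT.
have [|b hb] := h x; first by rewrite inE eqxx.
exists (a + `|b|); split=> [|y]; first by rewrite addr_ge0.
rewrite inE => /orP[/eqP ->|ys].
  by apply: mono hb; rewrite (le_trans (ler_norm b)) // lerDr.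
by apply: mono (ha _ ys); rewrite lerDl.
Qed.

(* The difference [x - P x] only contributes boundary terms, of size O(1/N). *)
Lemma avop_foelner (Js : seq (seq V)) K L P P' :
  (forall J, J \in Js -> forall u, exists c : nat -> int,
     u *+ L = \sum_(i < size J) J`_i *~ c i) ->
  avop (K * L) P P' -> exists C, 0 <= C /\ forall J, J \in Js ->
    forall x N, (0 < N)%N ->
    nm (mavs [seq w *+ K | w <- J] N (x - P x)) <= C * nm x / N%:R.
Proof.
move=> span; elim=> [u|{}P {}P' Q Q' hP [C [C0 hC]] hQ [D [D0 hD]]|
                     {}P {}P' Q Q' hP [C [C0 hC]] hQ [D [D0 hD]]].
- apply: (@seq_uniform_bound _ Js (fun J C => forall x N, (0 < N)%N ->
    nm (mavs [seq w *+ K | w <- J] N (x - U (u *+ (K * L)) x)) <= C * nm x / N%:R)).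
    move=> J a b ab h x N N0; apply: le_trans (h x N N0) _.
    by rewrite ler_wpM2r ?invr_ge0 ?ler0n // ler_wpM2r ?nm_ge0.
  move=> J JJs; have [c hc] := span J JJs u.
  exists (2 * (\sum_(i < size J) `|c i|%N)%:R) => x N N0.
  have -> : u *+ (K * L) = \sum_(i < size [seq w *+ K | w <- J])
      [seq w *+ K | w <- J]`_i *~ c i.
    rewrite mulnC mulrnA hc size_map -sumrMnl; apply: eq_bigr => i _.
    by rewrite (nth_map 0) // mulrzMnC.
  by rewrite -[in X in _ <= X](size_map (fun w => w *+ K)) nm_mavs_sub_rep.
- exists ((C + D) / 2); split=> [|J JJs x N N0]; first by lra.
  have -> : x - 2^-1 *: (P x + Q x) = 2^-1 *: ((x - P x) + (x - Q x)).
    rewrite addrACA -opprD scalerBr; congr (_ - _).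
    by rewrite half_scaleD.
  rewrite mavsZ mavsD nmZ ger0_norm ?invr_ge0 ?ler0n //.
  have := hC J JJs x N N0; have := hD J JJs x N N0.
  set p := mavs _ _ _; set q := mavs _ _ _; have := nmD q p; lra.
- exists (C + D); split=> [|J JJs x N N0]; first by lra.
  have -> : x - P (Q x) = (x - Q x) + (Q x - P (Q x)) by rewrite addrA subrK.
  rewrite mavsD (le_trans (nmD _ _)) // addrC !mulrDl lerD ?hD //.
  apply: le_trans (hC J JJs (Q x) N N0) _.
  rewrite ler_wpM2r ?invr_ge0 ?ler0n // ler_wpM2l //; exact: avop_nm hQ.
Qed.

(** If all pairs had correlation below [c ^+ 2 / 8], the sum [Z] of the vectors would satisfy
    [ip Z Z <= 4 m + m^2 c^2 / 8]. But [m c <= ip Z x <= 2 nm Z] gives [m^2 c^2 <= 4 ip Z Z], and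
    together these force [m c^2 <= 32]. *)
Lemma pair_correlation m (z : nat -> H) x c : 0 < c -> nm x <= 2 ->
  (forall b, (b < m)%N -> nm (z b) <= 2) ->
  (forall b, (b < m)%N -> c <= ip (z b) x) -> 32 / c ^+ 2 < m%:R ->
  exists b b', (b < b' < m)%N /\ c ^+ 2 / 8 <= ip (z b) (z b').
Proof.
move=> c0 x2 z2 cz; rewrite ltr_pdivrMr ?exprn_gt0 // => mc.
apply: contrapT => no.
have {}no b b' : (b < m)%N -> (b' < m)%N -> b != b' -> ip (z b) (z b') < c ^+ 2 / 8.
  wlog bb : b b' / (b < b')%N.
    move=> h bm bm' ne; have [l|l|e] := ltngtP b b'; first exact: h.
      by rewrite (ipC rep) h // eq_sym.
    by rewrite e eqxx in ne.
  move=> _ bm' _; rewrite ltNge; apply/negP => h; apply: no.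
  by exists b, b'; rewrite bb.
set Z := \sum_(b < m) z b.
have m0 : 0 < m%:R :> R.
  by rewrite -(pmulr_lgt0 _ (exprn_gt0 2 c0)); apply: lt_trans mc.
have h1 : m%:R * c <= ip Z x.
  rewrite ip_suml -sumr_ord_const.
  by apply: ler_sum => b _; apply: cz.
have h2 : ip Z x <= 2 * nm Z.
  apply: le_trans (ler_norm _) _; apply: le_trans (ip_le_nm _ _) _.
  by rewrite mulrC ler_wpM2r ?nm_ge0.
have h3 : ip Z Z <= 4 * m%:R + m%:R ^+ 2 * (c ^+ 2 / 8).
  have -> : 4 * m%:R + m%:R ^+ 2 * (c ^+ 2 / 8) =
      \sum_(b < m) (4 + \sum_(b' < m) c ^+ 2 / 8) :> R.
    rewrite !sumr_ord_const; ring.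
  rewrite ip_suml; apply: ler_sum => b _; rewrite ip_sumr.
  rewrite (bigD1 b) //= [X in _ <= _ + X](bigD1 b) //= lerD //.
    rewrite -nm_sqr (_ : 4 = 2 ^+ 2); last by ring.
    by rewrite ler_pXn2r ?nnegrE ?nm_ge0 ?z2.
  rewrite -[X in X <= _]add0r lerD ?divr_ge0 ?sqr_ge0 ?ler0n //.
  apply: ler_sum => b' bb; apply/ltW/no => //.
  by rewrite eq_sym; apply: contraNN bb => /eqP e; apply/eqP/val_inj.
have h4 : (m%:R * c) ^+ 2 <= 4 * ip Z Z.
  rewrite -nm_sqr (_ : 4 = 2 ^+ 2); last by ring.
  rewrite -exprMn; apply: lerXn2r; last exact: le_trans h1 h2.
    by rewrite nnegrE mulr_ge0 // ltW.
  by rewrite nnegrE mulr_ge0 // nm_ge0.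
have : m%:R * 32 < m%:R * (m%:R * c ^+ 2) by rewrite ltr_pM2l.
nra.
Qed.

(** Let [A] and [B] average along [J] and [J']. The adjoint [A^t] averages along the negated vectors
    and all these operators commute, so [<A^t A x, B^t B x> = |A B x|^2]: a correlation becomes the
    size of a composed average. *)
Lemma ip_mavs_sym J J' N x :
  ip (mavs [seq - w | w <- J] N (mavs J N x)) (mavs [seq - w | w <- J'] N (mavs J' N x)) =
  ip (mavs (J ++ J') N x) (mavs (J ++ J') N x).
Proof.
have oppK (s : seq V) : [seq - w | w <- [seq - w | w <- s]] = s.
  by rewrite -map_comp -[RHS]map_id; apply: eq_map => w /=; rewrite opprK.
by rewrite mavs_adj oppK mavsC -mavs_adj mavsC -!mavs_cat.
Qed.

(* Iterates [pair_correlation], which turns [m] large averages into a pair whose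
   composition is still large: blocks of indices double in length at each step. *)
Lemma doubling c j (ws : seq V) N x : 0 < c -> nm x <= 2 -> (0 < N)%N ->
  size ws = dbl_size c j ->
  (forall w, w \in ws -> c <= ip (mav w N x) (mav w N x)) ->
  exists J, [/\ subseq J ws, size J = (2 ^ j)%N &
    dbl_bound c j <= ip (mavs J N x) (mavs J N x)].
Proof.
move=> c0 x2 N0; elim: j ws => [|j IH] ws /=.
  case: ws => [|w []] //= _ h; exists [:: w]; split; rewrite //= ?eqxx //.
  by apply: h; rewrite inE.
set k := dbl_size c j; set d := dbl_bound c j; set m := (Num.truncn _).+1.
move=> sz h.
(* The induction hypothesis is applied to [m] consecutive blocks of [k] directions; [[::]] is a
   dummy value for later indices. *)
have /choice[F hF] : forall b, exists J, (b < m)%N ->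
    [/\ subseq J (take k (drop (b * k) ws)), size J = (2 ^ j)%N &
      d <= ip (mavs J N x) (mavs J N x)].
  move=> b; have [bm|bm] := boolP (b < m)%N; last by exists [::].
  have [||J hJ] := IH (take k (drop (b * k) ws)); last by exists J.
    rewrite size_take_min size_drop sz; apply/minn_idPl.
    by rewrite (mulnC k) -mulnBl leq_pmull // subn_gt0.
  by move=> w /mem_take /mem_drop; apply: h.
have d0 : 0 < d by apply: dbl_bound_gt0.
(* With [A] the average along [F b], the vector [A^t A x] has correlation [|A x|^2 >= d] with
   [x]. *)
have [|||b [b' [/andP[bb bm']]]] :=
    @pair_correlation m (fun b => mavs [seq - w | w <- F b] N (mavs (F b) N x)) x d d0 x2.
- move=> b _; apply: le_trans (nm_mavs _ _ N0) _.
  exact: le_trans (nm_mavs _ _ N0) _.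
- by move=> b /hF [_ _]; rewrite (ipC rep) -mavs_adj.
- exact: truncnS_gt.
have [s1 z1 _] := hF _ (ltn_trans bb bm'); have [s2 z2 _] := hF _ bm'.
rewrite ip_mavs_sym => hb; exists (F b ++ F b'); split=> //.
  exact: subseq_blocks s1 s2.
by rewrite size_cat z1 z2 expnS mul2n addnn.
Qed.

(** * Van der Corput's inequality for quadratic walks *)

Lemma avg_exchange N M (y : nat -> nat -> H) :
  avg N (fun i => avg M (y i)) = avg M (fun j => avg N (y^~ j)).
Proof.
rewrite /avg -!scaler_sumr !scalerA mulrC; congr (_ *: _); exact: exchange_big.
Qed.

(** Differencing: the increment of the quadratic walk over a step [g] is linear in [x], with slope
    [2 g w]. *)
Lemma quad_shift (q l w : V) x h g :
  q + l *+ (x + (h + g)) + w *+ ((x + (h + g)) ^ 2) =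
  (q + l *+ (x + h) + w *+ ((x + h) ^ 2)) +
  (w *+ (2 * g) *+ x + (l *+ g + w *+ (2 * g * h + g ^ 2))).
Proof.
have -> : ((x + (h + g)) ^ 2 = (x + h) ^ 2 + 2 * g * x + (2 * g * h + g ^ 2))%N by nia.
rewrite addnA (mulrnDr l) (mulrnDr w) (mulrnDr w ((x + h) ^ 2)) -(mulrnA w) !addrA.
congr (_ + _); rewrite -!addrA; do 2 congr (_ + _).
by rewrite addrC -addrA.
Qed.

(** Up to [4 h / N], the average equals an average [Y] of means over windows of length [h]. By
    convexity [|Y|^2] is bounded by correlations of [y (i + j)] and [y (i + j')]. The diagonal ones
    contribute [4 / h]. By [quad_shift] the others are averages along [2 g w] with
    [g = |j - j'| < h]; since [g] divides [h!], averages along [2 h! w] control all of them at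
    once. *)
Lemma van_der_corput x q l w h N' N c : nm x <= 2 -> (0 < h)%N ->
  (0 < N')%N -> (0 < N)%N ->
  nm (mav (w *+ (2 * h`!)) N' x) <= c ->
  exists a, [/\ 0 <= a,
    a ^+ 2 <= 4 / h%:R + 2 * (c + 4 * (2 * h`! * N')%:R / N%:R) &
    nm (avg N (fun i => U (q + l *+ i + w *+ (i ^ 2)) x)) <= a + 4 * h%:R / N%:R].
Proof.
move=> x2 h0 N'0 N0 hc; set y := fun i => U _ x.
have NR : 0 < N%:R :> R by rewrite ltr0n.
have hR : 0 < h%:R :> R by rewrite ltr0n.
have y2 i : nm (y i) <= 2 by rewrite nm_rep.
set Y := avg N (fun i => avg h (fun j => y (i + j)%N)).
exists (nm Y); split; first exact: nm_ge0.
- rewrite nm_sqr; apply: le_trans (ip_avg_le _ N0) _.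
  set e := c + _.
  have e0 : 0 <= e.
    by rewrite addr_ge0 ?(le_trans (nm_ge0 _) hc) // mulr_ge0 ?invr_ge0 ?mulr_ge0 ?ler0n.
  have G j g : (0 < g)%N -> (j + g < h)%N ->
      N%:R^-1 * (\sum_(i < N) ip (y (i + j)%N) (y (i + (j + g))%N)) <= 2 * e.
    move=> g0 jgh.
    have -> : N%:R^-1 * (\sum_(i < N) ip (y (i + j)%N) (y (i + (j + g))%N)) =
        ip x (mav (w *+ (2 * g)) N (U (l *+ g + w *+ (2 * g * j + g ^ 2)) x)).
      rewrite /mav ip_avgr; congr (_ * _); apply: eq_bigr => i _.
      by rewrite /y quad_shift (repD rep) (rep_iso rep) (repD rep).
    apply: le_trans (ler_norm _) _; apply: le_trans (ip_le_nm _ _) _.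
    apply: ler_pM; rewrite ?nm_ge0 // mav_rep nm_rep.
    have gf : (g %| h`!)%N by rewrite dvdn_fact // g0 /=; lia.
    set q' := (h`! %/ g)%N.
    apply: le_trans (@nm_mav_coarsen _ N q' N' _ N0 N'0) _.
    have -> : w *+ (2 * g) *+ q' = w *+ (2 * h`!).
      by rewrite -mulrnA -mulnA (mulnC g) divnK.
    rewrite lerD // ler_pM2r ?invr_gt0 //.
    have : (q' * N')%:R <= (2 * h`! * N')%:R :> R.
      rewrite ler_nat leq_mul2r (leq_trans (leq_div _ _)) ?orbT //.
      by rewrite leq_pmull.
    have := nm_ge0 x; set u := (q' * N')%:R; have : 0 <= u :> R by rewrite ler0n.
    nra.
  have {}G j j' : (j < h)%N -> (j' < h)%N ->
      N%:R^-1 * (\sum_(i < N) ip (y (i + j)%N) (y (i + j')%N)) <=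
      4 * (j == j')%:R + 2 * e.
    move=> jh jh'; case: (ltngtP j j') => jj.
    - by rewrite mulr0 add0r -(subnKC (ltnW jj)) G ?subn_gt0 ?subnKC // ltnW.
    - under eq_bigr do rewrite (ipC rep).
      by rewrite mulr0 add0r -(subnKC (ltnW jj)) G ?subn_gt0 ?subnKC // ltnW.
    - rewrite -jj mulr1 ler_pdivrMl //.
      apply: (@le_trans _ _ (\sum_(i < N) 4)).
        apply: ler_sum => i _; rewrite -nm_sqr (_ : 4 = 2 ^+ 2); last by ring.
        by rewrite ler_pXn2r ?nnegrE ?nm_ge0.
      rewrite sumr_ord_const ler_pM2l // lerDl; lra.
  have -> : N%:R^-1 * (\sum_(i < N)
        ip (avg h (fun j => y (i + j)%N)) (avg h (fun j => y (i + j)%N)))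
     = h%:R^-1 * (h%:R^-1 * \sum_(j < h) \sum_(j' < h)
         N%:R^-1 * (\sum_(i < N) ip (y (i + j)%N) (y (i + j')%N))).
    under eq_bigr do rewrite ip_avgl.
    under eq_bigr => i _.
      under eq_bigr do rewrite ip_avgr.
      rewrite -mulr_sumr.
      over.
    rewrite -!mulr_sumr.
    under [in RHS]eq_bigr do rewrite -mulr_sumr exchange_big.
    rewrite -mulr_sumr [in RHS]exchange_big /=; ring.
  rewrite ler_pdivrMl // ler_pdivrMl //.
  apply: (@le_trans _ _ (\sum_(j < h) \sum_(j' < h) (4 * (j == j' :> nat)%:R + 2 * e))).
    by apply: ler_sum => j _; apply: ler_sum => j' _; apply: G.
  have -> : \sum_(j < h) \sum_(j' < h) (4 * (j == j' :> nat)%:R + 2 * e) =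
      \sum_(j < h) (4 + h%:R * (2 * e)).
    apply: eq_bigr => j _; rewrite big_split /= sumr_ord_const.
    congr (_ + _); rewrite (bigD1 j) //= eqxx mulr1 big1 ?addr0 // => j' jj.
    by rewrite eq_sym (negPf (_ : (j' : nat) != j)) ?mulr0.
  rewrite sumr_ord_const.
  have -> : h%:R * (h%:R * (4 / h%:R + 2 * e)) = h%:R * (4 + h%:R * (2 * e)).
    by field; rewrite gt_eqF.
  by [].
- rewrite -[avg N y](subrK Y) addrC (le_trans (nmD _ _)) // lerD2l.
  have -> : avg N y - Y = avg h (fun j => avg N y - avg N (fun i => y (i + j)%N)).
    by rewrite avgB avg_cst // /Y avg_exchange.
  apply: nm_avg => // j jh.
  apply: le_trans (nm_avg_shift _ N0 y2) _; rewrite ler_pM2r ?invr_gt0 //.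
  have : j%:R <= h%:R :> R by rewrite ler_nat ltnW.
  lra.
Qed.

(** Let [r = b / 4]. Stability makes [z = P' (P xi)] almost invariant under multiples of [K], while
    [x = xi - z] averages to norm at most [r] along a suitable walk. Were all correlations along the
    walk nonpositive, the average of [<xi, U x>] would be at most [- (b - r) = - 3 r], a
    contradiction. *)
Lemma stable_recurrence b K L j h c (ws : seq V) P P' xi (O : V -> Prop) :
  0 < b -> nm xi <= 1 -> (0 < h)%N -> 0 < c ->
  64 / (b / 4) ^+ 2 <= h%:R -> c <= (b / 4) ^+ 2 / 32 ->
  b <= ip (P xi) (P xi) ->
  size ws = dbl_size (c ^+ 2) j ->
  (forall J, subseq J ws -> size J = (2 ^ j)%N -> forall u, exists d : nat -> int,
     u *+ L = \sum_(i < size J) J`_i *~ d i) ->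
  avop (K * (2 * h`!) * L) P P' ->
  (forall Q Q', avop K Q Q' -> ip (P xi) (P xi) <= ip (Q xi) (Q xi) + (b / 4) ^+ 2 / 4) ->
  (forall w, w \in ws -> exists q l, forall x, O (q + l *+ x + w *+ (x ^ 2))) ->
  exists o, O o /\ 0 < ip xi (U (o *+ K) xi).
Proof.
move=> b0 xi1 h0 c0 hh hc hb hws span avP stab hO.
set r := b / 4; have r0 : 0 < r by rewrite divr_gt0 ?ltr0n.
set z := P' (P xi); set x := xi - z.
have avPP : avop (K * (2 * h`!) * L) (fun x => P' (P x)) (fun x => P' (P x)).
  exact: avop_comp (avop_sym avP) avP.
have z1 : nm z <= 1 by apply: le_trans (avop_nm _ avPP) xi1.
have x2 : nm x <= 2 by apply: le_trans (nmB _ _) _; lra.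
have hz : b <= ip xi z by rewrite /z -(avop_adj _ _ avP).
have hinv u : nm (z - U (u *+ K) z) <= r.
  rewrite nm_le; last exact: ltW.
  have avK : avop K (fun x => P' (P x)) (fun x => P' (P x)).
    by apply: (@avop_mul _ (2 * h`! * L)); rewrite mulnA.
  (* The midpoint of [z] and its translate is also an average at level [K], so the
     parallelogram law bounds their distance. *)
  have := stab _ _ (avop_mid avK (avop_comp (avop_rep K u) avK)).
  have : ip z z <= ip (P xi) (P xi).
    rewrite -!nm_sqr ler_pXn2r ?nnegrE ?nm_ge0 //.
    exact: avop_nm (avop_sym avP).
  rewrite -/z !(ipZl, ipZr, ipDl, ipDr, ipNl, ipNr) (rep_iso rep)
    (ipC rep (U (u *+ K) z) z) -/r.
  lra.
(* If every direction failed for every length, [doubling] would give [2 ^ j] directions along which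
   the joint average of [x] stays large. They span a lattice containing all multiples of [L], so by
   [avop_foelner] that average tends to zero. *)
have [w [N' [wws N'0 hw]]] : exists w N', [/\ w \in ws, (0 < N')%N &
    nm (mav (w *+ (K * (2 * h`!))) N' x) <= c].
  apply: contrapT => no.
  have {}no N w : (0 < N)%N -> w \in ws ->
      c ^+ 2 <= ip (mav (w *+ (K * (2 * h`!))) N x) (mav (w *+ (K * (2 * h`!))) N x).
    move=> N0 wws; rewrite -nm_sqr ler_pXn2r ?nnegrE ?nm_ge0 ?ltW //.
    rewrite ltNge; apply/negP => h1; apply: no; by exists w, N.
  (* Listing all candidate subsequences makes the constant [C] below independent of [N], which is
     chosen after it. *)
  set Js := [seq J <- [seq mask (val t) ws | t : (size ws).-tuple bool] | size J == (2 ^ j)%N].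
  have [|C [C0 hC]] := @avop_foelner Js _ _ _ _ _ avPP.
    move=> J; rewrite mem_filter => /andP[/eqP sJ /mapP[t _ eJ]].
    by apply: span sJ; rewrite eJ mask_subseq.
  set d := dbl_bound (c ^+ 2) j.
  have d0 : 0 < d by rewrite dbl_bound_gt0 ?exprn_gt0.
  (* Makes [C / N] smaller than both [1] and [d], hence its square smaller than [d]. *)
  set N := (Num.truncn (C / d + C)).+1.
  have NR : 0 < N%:R :> R by rewrite ltr0n.
  have [|||J' [sJ' zJ' hJ']] := @doubling (c ^+ 2) j
      [seq w *+ (K * (2 * h`!)) | w <- ws] N x _ x2 isT; rewrite ?size_map ?exprn_gt0 //.
    by move=> w /mapP[v vws ->]; apply: no.
  have [m sm eJ'] := subseqP sJ'; rewrite size_map in sm; rewrite -map_mask in eJ'.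
  have := hC (mask m ws) _ xi N isT; rewrite -eJ' -/z -/x.
  have -> : mask m ws \in Js.
    rewrite mem_filter -zJ' eJ' size_map eqxx /=; apply/mapP.
    by exists (tcast sm (in_tuple m)); rewrite ?mem_enum // val_tcast.
  move=> /(_ isT) hJ.
  have hCN : C / d + C < N%:R by exact: truncnS_gt.
  have C1 : C / N%:R < 1.
    rewrite ltr_pdivrMr // mul1r; apply: le_lt_trans hCN.
    by rewrite lerDr divr_ge0 // ltW.
  have C2 : C / N%:R < d.
    rewrite ltr_pdivrMr // mulrC -ltr_pdivrMr //; apply: le_lt_trans hCN.
    by rewrite lerDl.
  have C3 : 0 <= C / N%:R by rewrite divr_ge0 ?ler0n.
  have : nm (mavs J' N x) <= C / N%:R.
    apply: le_trans hJ _; rewrite ler_pM2r ?invr_gt0 //.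
    by rewrite -[X in _ <= X]mulr1 ler_wpM2l.
  have := nm_ge0 (mavs J' N x).
  move: hJ'; rewrite -nm_sqr -/d; nra.
have [q [l hql]] := hO w wws.
set n1 := (2 * h`! * N')%N.
(* Makes both boundary errors of [van_der_corput] small: then [a ^+ 2 <= 3 r ^+ 2 / 16], so
   [a <= r / 2], and the averaged walk has norm at most [r]. *)
set N := (Num.truncn (16 * h%:R / r + 128 * n1%:R / r ^+ 2)).+1.
have NR : 0 < N%:R :> R by rewrite ltr0n.
have hN : 16 * h%:R / r + 128 * n1%:R / r ^+ 2 < N%:R by exact: truncnS_gt.
have e1 : 4 * h%:R / N%:R <= r / 4.
  rewrite ler_pdivrMr //; apply: ltW.
  have : 16 * h%:R / r < N%:R.
    by apply: le_lt_trans hN; rewrite lerDl divr_ge0 ?sqr_ge0 // mulr_ge0.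
  rewrite ltr_pdivrMr //; lra.
have e2 : 4 * n1%:R / N%:R <= r ^+ 2 / 32.
  rewrite ler_pdivrMr //; apply: ltW.
  have : 128 * n1%:R / r ^+ 2 < N%:R.
    apply: le_lt_trans hN; rewrite lerDr; apply: divr_ge0; last exact: ltW.
    by rewrite mulr_ge0 ?ler0n.
  rewrite ltr_pdivrMr ?exprn_gt0 //; lra.
have e3 : 4 / h%:R <= r ^+ 2 / 16.
  have hR : 0 < h%:R :> R by rewrite ltr0n.
  rewrite ler_pdivrMr //; move: hh; rewrite ler_pdivrMr ?exprn_gt0 // -/r; lra.
rewrite mulrnA in hw.
have [a [a0 ha hy]] := van_der_corput (q *+ K) (l *+ K) x2 h0 N'0 (isT : (0 < N)%N) hw.
move: ha hy; set y := fun i => U _ x => ha hy.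
have {}ha : a <= r / 2.
  have : a ^+ 2 <= (r / 2) ^+ 2.
    apply: le_trans ha _; rewrite -/n1.
    have -> : (r / 2) ^+ 2 = r ^+ 2 / 4 by field.
    move: hc; rewrite -/r; have := exprn_gt0 2 r0; lra.
  by rewrite ler_pXn2r // nnegrE divr_ge0 ?ler0n // ltW.
have {}hy : nm (avg N y) <= r by lra.
apply: contrapT => no.
have {}no i : ip xi (U ((q + l *+ i + w *+ (i ^ 2)) *+ K) xi) <= 0.
  rewrite leNgt; apply/negP => pos; apply: no.
  by exists (q + l *+ i + w *+ (i ^ 2)).
have xi_le t : `|ip xi t| <= nm t.
  by apply: le_trans (ip_le_nm _ _) _; rewrite ler_piMl ?nm_ge0.
(* Split [xi = x + z]: the correlation with the translate of [xi] is nonpositive, and that with the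
   translate of [z] is within [r] of [ip xi z >= b]. *)
have upper i : ip xi (y i) <= - (b - r).
  have := no i; rewrite -{2}[xi](subrK z) -/x rep_add ipDr !mulrnDl.
  rewrite (mulrnAC l) (mulrnAC w) -/(y i).
  set u := _ + _ + _.
  have := xi_le (z - U u z); have := ler_norm (ip xi (z - U u z)).
  have := hinv (q + l *+ i + w *+ (i ^ 2)).
  rewrite !mulrnDl (mulrnAC l) (mulrnAC w) -/u ipDr ipNr; lra.
have : ip xi (avg N y) <= - (b - r).
  rewrite ip_avgr ler_pdivrMl // -sumr_ord_const.
  by apply: ler_sum => i _.
have := xi_le (avg N y); have := ler_norm (- ip xi (avg N y)).
rewrite normrN; have : b = 4 * r by rewrite /r; field.
lra.
Qed.

(* As long as no level is stable, one gains [d] when passing from [E ^ i.+1] to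
   [E ^ i]. *)
Lemma stable_level E d xi m P0 P0' : avop (E ^ m) P0 P0' ->
  (exists i P P', [/\ (i < m)%N, avop (E ^ i.+1) P P' &
     forall Q Q', avop (E ^ i) Q Q' -> ip (P xi) (P xi) <= ip (Q xi) (Q xi) + d]) \/
  (exists Q : H -> H, ip (Q xi) (Q xi) + m%:R * d <= ip (P0 xi) (P0 xi)).
Proof.
elim: m P0 P0' => [|m IH] P0 P0' h0.
  by right; exists P0; rewrite mul0r addr0.
have [st|/existsNP[Q /existsNP[Q' /not_implyP[hQ /negP]]]] := pselect
    (forall Q Q', avop (E ^ m) Q Q' -> ip (P0 xi) (P0 xi) <= ip (Q xi) (Q xi) + d).
  by left; exists m, P0, P0'.
rewrite -ltNge => lt; have [[i [P [P' [im hP st]]]]|[Q1 hQ1]] := IH _ _ hQ.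
  by left; exists i, P, P'; split=> //; apply: ltnW.
by right; exists Q1; rewrite -natr1 mulrDl mul1r; lra.
Qed.

End Averages.

(** The order of choices matters: the number of directions depends on [b] and [j], the bound [k0]
    also on [L], and [k], a power of [E = 2 h! L], on the representation and [xi] but not on [O]. *)
Theorem uniform_recurrence (R : realType) (V : zmodType) (b : R) (j : nat) :
  0 < b -> exists m : nat, forall ws : seq V, size ws = m ->
  forall L : nat, (0 < L)%N ->
  (forall J, subseq J ws -> size J = (2 ^ j)%N -> forall u, exists d : nat -> int,
     u *+ L = \sum_(i < size J) J`_i *~ d i) ->
  exists k0 : nat, (0 < k0)%N /\
  forall (H : lmodType R) (ip : H -> H -> R) (U : V -> H -> H),
  unitary_rep ip U -> forall xi e : H, ip xi xi <= 1 ->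
  (forall u, U u e = e) -> ip e e = 1 -> b <= ip xi e ^+ 2 ->
  exists k : nat, (0 < k <= k0)%N /\ forall O : V -> Prop,
    (forall w, w \in ws -> exists q l, forall x, O (q + l *+ x + w *+ (x ^ 2))) ->
    exists o, O o /\ 0 < ip xi (U (o *+ k) xi).
Proof.
move=> b0; set r := b / 4; have r0 : 0 < r by rewrite divr_gt0 ?ltr0n.
set c := r ^+ 2 / 32; have c0 : 0 < c by rewrite divr_gt0 ?exprn_gt0 ?ltr0n.
set h := (Num.truncn (64 / r ^+ 2)).+1.
exists (dbl_size (c ^+ 2) j) => ws wsz L L0 span.
set E := (2 * h`! * L)%N; have E0 : (0 < E)%N by rewrite !muln_gt0 fact_gt0.
set d := r ^+ 2 / 4; have d0 : 0 < d by rewrite divr_gt0 ?exprn_gt0 ?ltr0n.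
set m := (Num.truncn d^-1).+1.
exists (E ^ m)%N; split=> [|H ip U rep xi e xi1 eU e1 bxi]; first by rewrite expn_gt0 E0.
(* Start from translation by [0], the identity: without a stable level, [m d <= ip xi xi <= 1],
   against [m > d^-1]. *)
have [[i [P [P' [im hP st]]]]|[Q hQ]] :=
    stable_level ip d xi (avop_rep U (E ^ m) 0); last first.
  have := ip_ge0 rep (Q xi); move: hQ; rewrite mul0rn !(rep0 rep).
  have : d^-1 < m%:R by exact: truncnS_gt.
  rewrite -[d^-1]mul1r ltr_pdivrMr //; lra.
exists (E ^ i)%N; split=> [|O hO].
  by rewrite expn_gt0 E0 /= leq_pexp2l // ltnW.
apply: (stable_recurrence rep (b := b) (h := h) (c := c) (j := j) (L := L)
  (ws := ws) (P := P) (P' := P')) => //.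
- by rewrite (nm_le rep) // expr1n.
- exact/ltW/truncnS_gt.
- by apply: le_trans bxi _; apply: (avop_lower rep _ eU e1 hP).
- by rewrite -mulnA -/E -expnSr.
Qed.

(** * Nilpotent matrices in general position *)

Lemma invmx_uniq (R : comUnitRingType) n (g h : 'M[R]_n) :
  \det g = 1 -> g *m h = 1%:M -> invmx g = h.
Proof.
move=> dg gh; have ug : g \in unitmx by rewrite unitmxE dg unitr1.
by rewrite -[LHS]mulmx1 -gh mulKmx.
Qed.

Lemma mul_delta_mx_delta (R : comNzRingType) n (A : 'M[R]_n) (i j k l : 'I_n) :
  delta_mx i j *m A *m delta_mx k l = A j k *: delta_mx i l.
Proof.
apply/matrixP => x y; rewrite !mxE (bigD1 k) //= big1 => [|z zk]; last first.
  by rewrite [X in _ * X]mxE (negPf zk) mulr0.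
rewrite !mxE (bigD1 j) //= big1 => [|z zj]; last by rewrite !mxE (negPf zj) andbF mul0r.
by rewrite !mxE !eqxx andbT /= !addr0; do 2!case: eqP => _; rewrite ?mulr1 ?mulr0 ?mul1r ?mul0r.
Qed.

Section TransvectionWords.
Variable n : nat.

(* [(i, j, a)] stands for the transvection [1 + a E_ij], a sequence of such
   triples for the product; the inverse [1 - a E_ij] is meaningful for [i != j]. *)
Definition tconj (R : comNzRingType) (t : 'I_n * 'I_n * R) (X : 'M[R]_n) : 'M[R]_n :=
  (1%:M + t.2 *: delta_mx t.1.1 t.1.2) *m X *m (1%:M - t.2 *: delta_mx t.1.1 t.1.2).

Definition wconj (R : comNzRingType) (s : seq ('I_n * 'I_n * R)) (X : 'M[R]_n) :=
  foldr (@tconj R) X s.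

Definition offdiag (R : comNzRingType) (s : seq ('I_n * 'I_n * R)) :=
  all (fun t => t.1.1 != t.1.2) s.

Definition wmap (R S : comNzRingType) (f : R -> S) (s : seq ('I_n * 'I_n * R)) :=
  [seq (t.1, f t.2) | t <- s].

Lemma wconj_cat (R : comNzRingType) (s s' : seq ('I_n * 'I_n * R)) X :
  wconj (s ++ s') X = wconj s (wconj s' X).
Proof. exact: foldr_cat. Qed.

Lemma offdiag_wmap (R S : comNzRingType) (f : R -> S) s :
  offdiag (wmap f s) = offdiag s.
Proof. by rewrite /offdiag all_map; apply: eq_all. Qed.

Lemma map_tconj (R S : comNzRingType) (f : {rmorphism R -> S}) t X :
  map_mx f (tconj t X) = tconj (t.1, f t.2) (map_mx f X).
Proof.
by rewrite /tconj !map_mxM map_mxD map_mxB !map_mxZ map_mx1 map_delta_mx.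
Qed.

Lemma map_wconj (R S : comNzRingType) (f : {rmorphism R -> S}) s X :
  map_mx f (wconj s X) = wconj (wmap f s) (map_mx f X).
Proof. by elim: s => //= t s IH; rewrite map_tconj IH. Qed.

Lemma tconjE (R : comNzRingType) i j (a : R) X :
  tconj (i, j, a) X = X + a *: (delta_mx i j *m X - X *m delta_mx i j)
    - a ^+ 2 *: (delta_mx i j *m X *m delta_mx i j).
Proof.
rewrite /tconj /= mulmxDl mul1mx mulmxBr mulmx1 -!scalemxAl -!scalemxAr.
rewrite mulmxDl -scalemxAl scalerDr scalerA -expr2 scalerBr !opprD !addrA.
by congr (_ - _).
Qed.

Lemma tconj0 (R : comNzRingType) ij X : tconj (ij, 0 : R) X = X.
Proof. by rewrite /tconj /= !scale0r subr0 addr0 mul1mx mulmx1. Qed.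

Lemma wconj0 (R S : comNzRingType) (s : seq ('I_n * 'I_n * R)) (X : 'M[S]_n) :
  wconj (wmap (fun=> 0 : S) s) X = X.
Proof. by elim: s => //= t s ->; rewrite tconj0. Qed.

Lemma det_transvection (R : comNzRingType) (i j : 'I_n) (a : R) : i != j ->
  \det (1%:M + a *: delta_mx i j : 'M[R]_n) = 1.
Proof.
have main (k l : 'I_n) (b : R) : (l < k)%N -> \det (1%:M + b *: delta_mx k l : 'M[R]_n) = 1.
  move=> lk; rewrite det_trig.
    rewrite big1 // => x _; rewrite !mxE eqxx.
    case: (x =P k) => [->|_]; last by rewrite mulr0 addr0.
    by rewrite -val_eqE /= (gtn_eqF lk) mulr0 addr0.
  apply/is_trig_mxP => x y xy; rewrite !mxE -!val_eqE /= (ltn_eqF xy) add0r.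
  case: eqP => [xk|]; last by rewrite mulr0.
  by rewrite gtn_eqF ?mulr0 //; lia.
move=> ij; have [lt|lt|/val_inj e] := ltngtP j i; first exact: main.
  rewrite -det_tr linearD linearZ /= trmx1 trmx_delta; exact: main.
by rewrite e eqxx in ij.
Qed.

Lemma wconj_conj (R : comUnitRingType) (s : seq ('I_n * 'I_n * R)) : offdiag s ->
  exists g : 'M[R]_n, \det g = 1 /\ forall X, wconj s X = g *m X *m invmx g.
Proof.
move=> hs; suff [g [h [dg gh E]]] : exists g h : 'M[R]_n,
    [/\ \det g = 1, g *m h = 1%:M & forall X, wconj s X = g *m X *m h].
  by exists g; split=> // X; rewrite (invmx_uniq dg gh).
elim: s hs => [|[[i j] a] s IH] /=.
  by exists 1%:M, 1%:M; split=> [||X]; rewrite ?det1 ?mulmx1 ?mul1mx.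
move=> /andP[/= ij /IH[g [h [dg gh E]]]].
exists ((1%:M + a *: delta_mx i j) *m g), (h *m (1%:M - a *: delta_mx i j)).
split=> [||X].
- by rewrite det_mulmx det_transvection // dg mulr1.
- rewrite mulmxA -[_ *m g *m h]mulmxA gh mulmx1 mulmxDl mul1mx mulmxBr mulmx1.
  rewrite -scalemxAl -scalemxAr mul_delta_mx_0 1?eq_sym // !scaler0 subr0.
  by rewrite subrK.
- by rewrite E /tconj /= !mulmxA.
Qed.

Variables (i0 i1 : 'I_n).
Hypothesis i01 : i0 != i1.

(** The nilpotents [g E_01 g^-1]. Keeping the word instead of the matrix [g] allows the deformation
    [wpath]. *)
Definition wnil (s : seq ('I_n * 'I_n * int)) : 'M[int]_n :=
  wconj s (delta_mx i0 i1).

Definition ratmx (A : 'M[int]_n) : 'M[rat]_n := map_mx (fun a : int => a%:~R) A.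

Lemma ratmx_inj : injective ratmx.
Proof.
move=> A B /matrixP e; apply/matrixP => i j.
by have := e i j; rewrite !mxE => /intr_inj.
Qed.

Lemma wnil_span (S : {vspace 'M[rat]_n}) :
  (forall s, offdiag s -> ratmx (wnil s) \in S) ->
  forall u : 'M[rat]_n, \tr u = 0 -> u \in S.
Proof.
(* [Z] is stable under conjugation by transvections, hence under brackets with
   the [E_ij]; starting from [E_01] this yields a spanning set of sl_n. *)
move=> hS.
pose Z X := forall s : seq ('I_n * 'I_n * int), offdiag s ->
  wconj (wmap intr s) X \in S.
have linc (s : seq ('I_n * 'I_n * rat)) (a : rat) X Y :
    wconj s (a *: X + Y) = a *: wconj s X + wconj s Y.
  elim: s => //= t s ->; rewrite /tconj; move: (1%:M + _) (1%:M - _) => P Q.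
  rewrite mulmxDr mulmxDl.
  by rewrite -scalemxAr -scalemxAl.
have ZP a X Y : Z X -> Z Y -> Z (a *: X + Y).
  by move=> hX hY s hs; rewrite linc memvD ?memvZ ?hX ?hY.
have ZZ a X : Z X -> Z (a *: X).
  move=> hX; have Z0 : Z 0.
    move=> s hs; have := linc (wmap intr s) (-1) 0 0.
    by rewrite scaler0 addr0 scaleN1r addNr => ->; rewrite mem0v.
  by rewrite -[_ *: _]addr0; apply: ZP.
have ZB X Y : Z X -> Z Y -> Z (X - Y).
  by move=> hX hY; rewrite addrC -scaleN1r; apply: ZP.
have ZT i j (a : int) X : i != j -> Z X -> Z (tconj (i, j, a%:~R) X).
  move=> ij hX s hs; have := hX (rcons s (i, j, a)).
  rewrite /offdiag all_rcons /= ij => /(_ hs).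
  by rewrite /wmap map_rcons -cats1 wconj_cat.
(* The parameters [1] and [-1] separate the linear and quadratic terms of [tconjE], by
   half-difference and half-sum. *)
have ZE i j X : i != j -> Z X -> Z (delta_mx i j *m X *m delta_mx i j) /\
    Z (delta_mx i j *m X - X *m delta_mx i j).
  move=> ij hX; have := ZB _ _ (ZT i j 1 X ij hX) hX.
  have := ZB _ _ (ZT i j (-1) X ij hX) hX.
  rewrite !tconjE; set A := _ *m _ *m _; set B := _ - _ *m _.
  have -> : X + (-1)%:~R *: B - (-1)%:~R ^+ 2 *: A - X = - B - A.
    by rewrite mulrN1z sqrrN expr1n scaleN1r scale1r -[X + _ - _]addrA [X + _]addrC addrK.
  have -> : X + 1%:~R *: B - 1%:~R ^+ 2 *: A - X = B - A.
    by rewrite mulr1z expr1n !scale1r -[X + _ - _]addrA [X + _]addrC addrK.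
  move=> h1 h2; split.
    have := ZZ (- 2^-1) _ (ZP 1 _ _ h1 h2); rewrite scale1r addrACA addNr add0r -opprD scalerN.
    by rewrite -mulr2n -scaler_nat scalerA mulNr mulVf // scaleN1r opprK.
  have := ZZ (2^-1) _ (ZB _ _ h2 h1); rewrite opprD !opprK addrACA addNr addr0.
  by rewrite -mulr2n -scaler_nat scalerA mulVf // scale1r.
have Z01 : Z (delta_mx i0 i1).
  move=> s hs; have := hS s hs; rewrite /ratmx /wnil map_wconj.
  by rewrite map_delta_mx.
have Zl i j k : i != j -> k != i -> k != j -> Z (delta_mx i j) -> Z (delta_mx k j).
  move=> ij ki kj /(ZE k i _ ki)[_].
  by rewrite mul_delta_mx mul_delta_mx_0 ?subr0 // eq_sym.
have Zr i j k : i != j -> k != i -> k != j -> Z (delta_mx i j) -> Z (delta_mx i k).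
  move=> ij ki kj h; have jk : j != k by rewrite eq_sym.
  have [_] := ZE j k _ jk h.
  rewrite mul_delta_mx mul_delta_mx_0 // sub0r => /(ZZ (-1)).
  by rewrite scaleN1r opprK.
have Zt i j : i != j -> Z (delta_mx i j) -> Z (delta_mx j i) /\
    Z (delta_mx j j - delta_mx i i).
  move=> ij /(ZE j i); rewrite eq_sym => /(_ ij)[].
  by rewrite !mul_delta_mx.
have Zk1 k : k != i1 -> Z (delta_mx k i1).
  by move=> k1; have [->//|k0] := eqVneq k i0; apply: (Zl i0).
have Zkl k l : k != l -> Z (delta_mx k l).
  move=> kl; have [k1|k1] := eqVneq k i1.
    have l1 : l != i1 by rewrite -k1 eq_sym.
    by rewrite k1; apply: (Zt _ _ l1 (Zk1 _ l1)).1.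
  have [->|l1] := eqVneq l i1; first exact: Zk1.
  by apply: (Zr _ i1) => //; [rewrite eq_sym | apply: Zk1].
have Zd k : Z (delta_mx k k - delta_mx i0 i0).
  have [->|k0] := eqVneq k i0.
    by rewrite subrr -(scale0r (delta_mx i0 i1)); apply: ZZ.
  by apply: (Zt i0 k _ (Zkl _ _ _)).2; rewrite eq_sym.
have Zin X : Z X -> X \in S by move/(_ [::] isT).
move=> u tu.
(* As [u] has trace zero, the corrections by [E_00] on the diagonal cancel. *)
have -> : u = \sum_i \sum_j u i j *: (delta_mx i j - (i == j)%:R *: delta_mx i0 i0).
  rewrite {1}[u]matrix_sum_delta.
  under [RHS]eq_bigr do under eq_bigr do rewrite scalerBr scalerA.
  under [RHS]eq_bigr do rewrite sumrB -scaler_suml.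
  rewrite sumrB -scaler_suml (_ : \sum_(i < n) _ = \tr u) ?tu ?scale0r ?subr0 //.
  rewrite -[RHS]tu; apply: eq_bigr => i _.
  rewrite (bigD1 i) //= eqxx mulr1 big1 ?addr0 // => j ji.
  by rewrite eq_sym (negPf ji) mulr0.
apply: memv_suml => i _; apply: memv_suml => j _; apply: memvZ; apply: Zin.
have [->|ij] := eqVneq i j; first by rewrite scale1r; apply: Zd.
by rewrite scale0r subr0; apply: Zkl.
Qed.

(** A polynomial path in [z] from [s0] at [0] to [s1] at [1]: one word fades out while the other
    fades in. *)
Definition wpath (s0 s1 : seq ('I_n * 'I_n * int)) (z : int) :=
  wmap (fun a => a * (1 - z)) s0 ++ wmap (fun a => a * z) s1.

Lemma wpath0 s0 s1 : wnil (wpath s0 s1 0) = wnil s0.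
Proof.
rewrite /wnil wconj_cat (_ : wmap _ s1 = wmap (fun=> 0) s1); last first.
  by apply: eq_map => t; rewrite mulr0.
rewrite wconj0 (_ : wmap _ s0 = s0) //; rewrite -[RHS]map_id.
by apply: eq_map => -[ij a]; rewrite subr0 mulr1.
Qed.

Lemma wpath1 s0 s1 : wnil (wpath s0 s1 1) = wnil s1.
Proof.
rewrite /wnil wconj_cat (_ : wmap _ s0 = wmap (fun=> 0) s0); last first.
  by apply: eq_map => t; rewrite subrr mulr0.
rewrite wconj0 (_ : wmap _ s1 = s1) //; rewrite -[RHS]map_id.
by apply: eq_map => -[ij a]; rewrite mulr1.
Qed.

Lemma offdiag_wpath s0 s1 z : offdiag s0 -> offdiag s1 -> offdiag (wpath s0 s1 z).
Proof.
by move=> h0 h1; rewrite /offdiag all_cat; apply/andP; split; rewrite -/(offdiag _) offdiag_wmap.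
Qed.

Lemma wpath_poly s0 s1 : exists A : 'M[{poly int}]_n,
  forall z, wnil (wpath s0 s1 z) = map_mx (horner_eval z) A.
Proof.
exists (wconj (wmap (fun a => a%:P * (1 - 'X)) s0 ++ wmap (fun a => a%:P * 'X) s1)
  (delta_mx i0 i1)) => z.
rewrite map_wconj map_delta_mx /wnil; congr (wconj _ _).
rewrite /wmap map_cat -!map_comp; congr (_ ++ _); apply: eq_map => t /=;
  by rewrite /horner_eval !hornerE.
Qed.

(** The entries of [u - projv S u] are linear equations for [S]. One that fails at [z0] becomes a
    nonzero polynomial in [z] along the path. *)
Lemma wpath_avoid (S : {vspace 'M[rat]_n}) s0 s1 z0 :
  ratmx (wnil (wpath s0 s1 z0)) \notin S ->
  exists p : {poly rat}, p != 0 /\ forall z : int, p.[z%:~R] != 0 ->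
    ratmx (wnil (wpath s0 s1 z)) \notin S.
Proof.
have [A hA] := wpath_poly s0 s1.
pose f (i j : 'I_n) (u : 'M[rat]_n) : rat := (u - projv S u) i j.
have fE i j u : f i j u = \sum_k \sum_l u k l * f i j (delta_mx k l).
  rewrite /f {1 2}[u]matrix_sum_delta linear_sum -sumrB summxE.
  apply: eq_bigr => k _; rewrite linear_sum -sumrB summxE; apply: eq_bigr => l _.
  by rewrite linearZ -scalerBr mxE.
move=> nS; have [i [j nz]] : exists i j, f i j (ratmx (wnil (wpath s0 s1 z0))) != 0.
  apply: contrapT => no; move/negP: nS; apply.
  suff /eqP : ratmx (wnil (wpath s0 s1 z0)) - projv S (ratmx (wnil (wpath s0 s1 z0))) = 0.
    by rewrite subr_eq0 => /eqP ->; apply: memv_proj.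
  apply/matrixP => i j; rewrite [RHS]mxE; apply/eqP/negPn/negP => h.
  by apply: no; exists i, j.
pose p : {poly rat} := \sum_k \sum_l f i j (delta_mx k l) *: map_poly intr (A k l).
have pE z : p.[z%:~R] = f i j (ratmx (wnil (wpath s0 s1 z))).
  rewrite fE horner_sum; apply: eq_bigr => k _.
  rewrite horner_sum; apply: eq_bigr => l _.
  by rewrite hornerZ horner_map mulrC hA !mxE.
exists p; split=> [|z].
  by apply: contraNneq nz => p0; rewrite -pE p0 horner0.
rewrite pE; apply: contraNN => inS.
by rewrite /f projv_id // subrr mxE.
Qed.

Lemma poly_int_nonroot (p : {poly rat}) : p != 0 -> exists z : int, p.[z%:~R] != 0.
Proof.
move=> p0; apply: contrapT => no.
pose rs : seq rat := [seq (i%:Z)%:~R | i <- iota 0 (size p)].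
have rt : all (root p) rs.
  apply/allP => x /mapP[i _ ->]; rewrite rootE; apply/negPn/negP => h.
  by apply: no; exists i%:Z.
have un : uniq rs by rewrite map_inj_uniq ?iota_uniq // => x y /intr_inj [].
by have := max_poly_roots p0 rt un; rewrite size_map size_iota ltnn.
Qed.

(** The nilpotents behave like an irreducible variety. Join a word avoiding all subspaces but one to
    a word avoiding the last; only finitely many parameters on the path are bad. *)
Lemma wnil_avoid (Ss : seq {vspace 'M[rat]_n}) :
  (forall S, S \in Ss -> exists2 s, offdiag s & ratmx (wnil s) \notin S) ->
  exists2 s, offdiag s & forall S, S \in Ss -> ratmx (wnil s) \notin S.
Proof.
elim: Ss => [|S Ss IH] h; first by exists [::].
have [|s0 h0 hs0] := IH; first by move=> S' h'; apply: h; rewrite inE h' orbT.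
have [|s1 h1 hs1] := h S; first by rewrite inE eqxx.
have [p [p0 hp]] : exists p : {poly rat}, p != 0 /\ forall z : int, p.[z%:~R] != 0 ->
    forall S', S' \in Ss -> ratmx (wnil (wpath s0 s1 z)) \notin S'.
  elim: Ss hs0 {h IH} => [|S' Ss IH] hs0; first by exists 1; rewrite oner_eq0.
  have [|p [p0 hp]] := IH; first by move=> T hT; apply: hs0; rewrite inE hT orbT.
  have [|q [q0 hq]] := @wpath_avoid S' s0 s1 0.
    by rewrite wpath0; apply: hs0; rewrite inE eqxx.
  exists (q * p); split=> [|z]; first by rewrite mulf_neq0.
  rewrite hornerM mulf_eq0 negb_or => /andP[hqz hpz] T.
  by rewrite inE => /orP[/eqP->|]; [apply: hq | apply: hp].
have [|q [q0 hq]] := @wpath_avoid S s0 s1 1; first by rewrite wpath1.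
have [|z] := @poly_int_nonroot (q * p); first by rewrite mulf_neq0.
rewrite hornerM mulf_eq0 negb_or => /andP[hqz hpz].
exists (wpath s0 s1 z) => [|T]; first exact: offdiag_wpath.
by rewrite inE => /orP[/eqP->|]; [apply: hq | apply: hp].
Qed.

(** Words are added one at a time, each chosen outside the span of every earlier subfamily that does
    not yet span all traceless matrices; [wnil_span] makes this possible. *)
Lemma wnil_general_position m : exists ss : seq (seq ('I_n * 'I_n * int)),
  [/\ size ss = m, all (@offdiag _) ss &
    forall J, subseq J [seq ratmx (wnil s) | s <- ss] ->
      free J \/ forall u : 'M[rat]_n, \tr u = 0 -> u \in <<J>>%VS].
Proof.
elim: m => [|m [ss [sz off gp]]].
  exists [::]; split=> // J; rewrite subseq0 => /eqP ->; left; exact: nil_free.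
set ws := [seq ratmx (wnil s) | s <- ss] in gp.
pose full (S : {vspace 'M[rat]_n}) := forall u : 'M[rat]_n, \tr u = 0 -> u \in S.
pose Ss := [seq S <- [seq <<mask (val t) ws>>%VS | t : (size ws).-tuple bool] | ~~ `[< full S >]].
have [|s hs avoid] := @wnil_avoid Ss.
  move=> S; rewrite mem_filter => /andP[/asboolPn nf _].
  apply: contrapT => no; apply: nf; apply: wnil_span => s hs.
  by apply/negPn/negP => h; apply: no; exists s.
exists (s :: ss); split; rewrite /= ?sz ?hs // -/ws => J.
case: J => [|w J]; first by left; apply: nil_free.
have [|] := boolP (subseq (w :: J) ws); first by move/gp.
move=> nsub; rewrite /=; case: eqP => [->|_] sub; last by rewrite sub in nsub.
have [fJ|fullJ] := gp J sub; last first.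
  by right=> u /fullJ; apply: subvP; rewrite span_cons addvSr.
have [fu|nfu] := pselect (full <<J>>%VS).
  by right=> u /fu; apply: subvP; rewrite span_cons addvSr.
left; rewrite free_cons fJ andbT; apply: avoid.
rewrite mem_filter; apply/andP; split; first exact/asboolPn.
have [b sb eJ] := subseqP sub; apply/mapP.
exists (tcast sb (in_tuple b)); first by rewrite mem_enum.
by rewrite /= val_tcast -eJ.
Qed.

(** [coord] is linear on the whole matrix space, so the product [L] of the denominators of its
    values at the [E_kl] clears the coordinates of every integer matrix. *)
Lemma span_int_multiple (J : seq 'M[int]_n) :
  (forall u : 'M[rat]_n, \tr u = 0 -> u \in <<[seq ratmx w | w <- J]>>%VS) ->
  exists L : nat, (0 < L)%N /\ forall u : 'M[int]_n, \tr u = 0 ->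
    exists d : nat -> int, u *+ L = \sum_(i < size J) J`_i *~ d i.
Proof.
move=> full; pose X := in_tuple [seq ratmx w | w <- J].
pose co i k l := coord X i (delta_mx k l).
pose L := (\prod_i \prod_k \prod_l `|denq (co i k l)|)%N.
have L0 : (0 < L)%N.
  by do 3!(apply: prodn_gt0 => ?); rewrite absz_gt0 denq_neq0.
exists L; split=> // u tu.
have tu' : \tr (ratmx u) = 0 by rewrite /ratmx trace_map_mx tu.
have := coord_span (full _ tu' : ratmx u \in <<X>>%VS).
have coI i : L%:R * coord X i (ratmx u) \is a Num.int.
  rewrite [ratmx u]matrix_sum_delta linear_sum mulr_sumr rpred_sum // => k _.
  rewrite linear_sum mulr_sumr rpred_sum // => l _.
  rewrite linearZ /= mulrCA rpredM //; first by rewrite mxE intr_int.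
  have /dvdnP[m ->] : (`|denq (co i k l)| %| L)%N.
    by rewrite /L (bigD1 i) //= (bigD1 k) //= (bigD1 l) //= -!mulnA dvdn_mulr.
  rewrite natrM -mulrA natr_absz ger0_norm ?denq_ge0 // mulrC [_%:~R * _]mulrC -numqE.
  by rewrite rpredM // ?intr_int // natr_int.
have /choice[d hd] : forall i : nat, exists z : int,
    forall h : (i < size [seq ratmx w | w <- J])%N,
    L%:R * coord X (Ordinal h) (ratmx u) = z%:~R.
  move=> i; have [h|h] := pselect (i < size [seq ratmx w | w <- J])%N; last first.
    by exists 0 => h'; case: h.
  have /intrP[z hz] := coI (Ordinal h); exists z => h'.
  by rewrite (bool_irrelevance h' h).
move=> uE; exists d; apply: ratmx_inj.
rewrite [LHS](_ : _ = L%:R *: ratmx u); last first.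
  by rewrite /ratmx scaler_nat raddfMn.
rewrite uE scaler_sumr /ratmx raddf_sum -/ratmx.
rewrite (eq_bigr (fun i : 'I_(size [seq ratmx w | w <- J]) => (d i)%:~R *: ratmx J`_i)); last first.
  move=> [i h] _; rewrite scalerA hd /= (nth_map 0) //.
  by rewrite size_map in h.
rewrite size_map; apply: eq_bigr => i _.
by rewrite raddfMz scaler_int.
Qed.

Lemma seq_uniform_multiple (T : eqType) (s : seq T) (Q : T -> nat -> Prop) :
  (forall x a b, Q x a -> Q x (a * b)%N) ->
  (forall x, x \in s -> exists a, (0 < a)%N /\ Q x a) ->
  exists a, (0 < a)%N /\ forall x, x \in s -> Q x a.
Proof.
move=> mono; elim: s => [|x s IH] h; first by exists 1%N.
have [|a [a0 ha]] := IH; first by move=> y ys; apply: h; rewrite inE ys orbT.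
have [|b [b0 hb]] := h x; first by rewrite inE eqxx.
exists (b * a)%N; split=> [|y]; first by rewrite muln_gt0 b0.
rewrite inE => /orP[/eqP ->|ys]; first exact: mono.
by rewrite mulnC; apply: mono (ha _ ys).
Qed.

(** More than [n * n] matrices cannot be free, so general position makes them span. A single [L]
    serves the finitely many subsequences of size [k]. *)
Lemma nilpotent_general_position m k : (n * n < k)%N ->
  exists gs : seq 'M[int]_n, [/\ size gs = m, forall g, g \in gs -> \det g = 1 &
  exists L : nat, (0 < L)%N /\
  forall J, subseq J [seq g *m delta_mx i0 i1 *m invmx g | g <- gs] -> size J = k ->
  forall u : 'M[int]_n, \tr u = 0 ->
    exists d : nat -> int, u *+ L = \sum_(i < size J) J`_i *~ d i].
Proof.
move=> nk; have [ss [sz off gp]] := wnil_general_position m.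
have /choice[G hG] : forall s : seq ('I_n * 'I_n * int), exists g : 'M[int]_n,
    offdiag s -> \det g = 1 /\ wnil s = g *m delta_mx i0 i1 *m invmx g.
  move=> s; have [hs|] := boolP (offdiag s); last by exists 0.
  by have [g [dg hg]] := wconj_conj hs; exists g => _; rewrite /wnil hg.
exists [seq G s | s <- ss]; split; first by rewrite size_map.
  by move=> g /mapP[s sss ->]; apply: (hG _ (allP off _ sss)).1.
have -> : [seq g *m delta_mx i0 i1 *m invmx g | g <- [seq G s | s <- ss]] =
    [seq wnil s | s <- ss].
  by rewrite -map_comp; apply/eq_in_map => s sss /=; rewrite -(hG _ (allP off _ sss)).2.
set ws := [seq wnil s | s <- ss].
pose Js := [seq J <- [seq mask (val t) ws | t : (size ws).-tuple bool] | size J == k].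
have [|J|L [L0 hL]] := @seq_uniform_multiple _ Js (fun J L => forall u : 'M[int]_n,
    \tr u = 0 -> exists d : nat -> int, u *+ L = \sum_(i < size J) J`_i *~ d i).
- move=> J a b h u tu; have [d hd] := h u tu; exists (fun i => d i * b%:Z).
  rewrite mulrnA hd -sumrMnl; apply: eq_bigr => i _.
  by rewrite mulrzA.
- rewrite mem_filter => /andP[/eqP szJ /mapP[t _ eJ]].
  apply: span_int_multiple.
  have [|fr|//] := gp [seq ratmx w | w <- J].
    by rewrite eJ map_mask /ws -map_comp mask_subseq.
  have : (\dim <<[seq ratmx w | w <- J]>>%VS <= n * n)%N.
    by apply: leq_trans (dimvS (subvf _)) _; rewrite dimvf dim_matrix.
  by rewrite (eqP fr) size_map szJ leqNgt nk.
exists L; split=> // J sub szJ; apply: hL; rewrite mem_filter szJ eqxx /=.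
have [b sb eJ] := subseqP sub; apply/mapP.
exists (tcast sb (in_tuple b)); first by rewrite mem_enum.
by rewrite /= val_tcast -eJ.
Qed.

End TransvectionWords.

(** * The Koopman representation *)

Section BoundedMeasurable.
Context {d : measure_display} (X : measurableType d) (R : realType).

(** Bounded measurable functions stand in for L^2: they are stable under the action and their
    products are integrable. [R^o] is [R] as a module over itself. *)
Definition bounded_measurable : {pred X -> R^o} := fun f =>
  `[< measurable_fun [set: X] (f : X -> R) /\
      exists M : R, forall x, `|f x : R| <= M >].

Fact bounded_measurable_submod_closed : submod_closed bounded_measurable.
Proof.
split=> [|a f g /asboolP[mf [M hM]] /asboolP[mg [N hN]]]; apply/asboolP; split.
- exact: measurable_cst.
- by exists 0 => x; rewrite normr0.
- by apply: measurable_funD => //; apply: measurable_funM => //; apply: measurable_cst.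
- exists (`|a| * M + N) => x; rewrite (le_trans (ler_normD _ _)) // lerD //.
  by rewrite normrM ler_wpM2l.
Qed.

HB.instance Definition _ := GRing.isSubmodClosed.Build R (X -> R^o)
  bounded_measurable bounded_measurable_submod_closed.

Record bmfun := BMFun { bmval : X -> R^o; _ : bmval \in bounded_measurable }.

HB.instance Definition _ := [isSub for bmval].
HB.instance Definition _ := [Choice of bmfun by <:].
HB.instance Definition _ := [SubChoice_isSubLmodule of bmfun by <:].

Lemma bmfunP (f : bmfun) : measurable_fun [set: X] (bmval f : X -> R) /\
  exists M : R, forall x, `|bmval f x : R| <= M.
Proof. by case: f => f hf; apply/asboolP. Qed.

End BoundedMeasurable.

Section KoopmanRepresentation.
Context {d : measure_display} (X : measurableType d) (R : realType).
Variables (mu : probability X R) (V : zmodType) (T : V -> X -> X).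
Hypothesis actT : mp_action [set: V] mu T.

Let mT v : measurable_fun [set: X] (T v).
Proof. by case: actT => _ _ h _; apply: h. Qed.

Definition l2ip (f g : bmfun X R) : R := (\int[mu]_x (bmval f x * bmval g x))%R.

Lemma bounded_integrable (f : X -> R) : measurable_fun [set: X] f ->
  (exists M : R, forall x, `|f x| <= M) -> mu.-integrable [set: X] (EFin \o f).
Proof.
move=> mf [M hM]; apply: measurable_bounded_integrable => //.
  by apply: le_lt_trans (probability_le1 mu measurableT) _; rewrite ltry.
exists M; split; first exact: num_real.
by move=> y My x _; apply: le_trans (hM x) (ltW My).
Qed.

Lemma bmfunM_integrable (f g : bmfun X R) :
  mu.-integrable [set: X] (EFin \o (fun x => bmval f x * bmval g x : R)).
Proof.
have [mf [M hM]] := bmfunP f; have [mg [N hN]] := bmfunP g.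
apply: bounded_integrable; first exact: measurable_funM.
by exists (M * N) => x; rewrite normrM ler_pM.
Qed.

Lemma Rintegral_comp (f : X -> R) v : measurable_fun [set: X] f ->
  (exists M : R, forall x, `|f x| <= M) ->
  (\int[mu]_x f (T v x) = \int[mu]_x f x)%R.
Proof.
move=> mf [M hM]; rewrite /Rintegral; congr fine.
have intf : mu.-integrable (T v @^-1` [set: X]) ((EFin \o f) \o T v).
  rewrite preimage_setT; apply: (@bounded_integrable (f \o T v)).
    exact: measurableT_comp.
  by exists M => x; apply: hM.
have /measurable_EFinP mEf := mf.
have := integral_pushforward (mT v) mEf intf measurableT.
rewrite preimage_setT => <-; apply: eq_measure_integral => A mA _.
by rewrite /pushforward; case: actT => _ _ _ h; apply: h.
Qed.

Lemma koopman_subproof v (f : bmfun X R) :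
  (fun x => bmval f (T (- v) x)) \in @bounded_measurable d X R.
Proof.
have [mf [M hM]] := bmfunP f; apply/asboolP; split.
  exact: (measurableT_comp mf (mT (- v))).
by exists M => x; apply: hM.
Qed.

(** Composing with [T (- v)] sends the indicator of [B] to that of the image of [B] under [T v]. *)
Definition koopman v (f : bmfun X R) : bmfun X R := BMFun (koopman_subproof v f).

Lemma koopman_unitary : unitary_rep l2ip koopman.
Proof.
split.
- by move=> f g; apply: eq_Rintegral => x _; rewrite mulrC.
- move=> a f g h.
  have -> : l2ip (a *: f + g) h =
     (\int[mu]_x (a * (bmval f x * bmval h x) + bmval g x * bmval h x))%R.
    by apply: eq_Rintegral => x _; rewrite mulrDl -mulrA.
  have int1 := bmfunM_integrable f h; have int2 := bmfunM_integrable g h.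
  rewrite RintegralD //; first by rewrite RintegralZl.
  have := bmfunM_integrable (a *: f) h.
  by congr (integrable _ _ _); apply/funext => x /=; rewrite mulrA.
- by move=> f; apply: Rintegral_ge0 => x _; rewrite -expr2 sqr_ge0.
- by move=> v a f g; apply: val_inj.
- move=> f; apply: val_inj; apply/funext => x /=.
  by case: actT => h _ _ _; rewrite oppr0 h.
- move=> u v f; apply: val_inj; apply/funext => x /=.
  by case: actT => _ h _ _; rewrite opprD addrC h.
- move=> v f g; have [mf [M hM]] := bmfunP f; have [mg [N hN]] := bmfunP g.
  apply: (@Rintegral_comp (fun x => bmval f x * bmval g x)).
    exact: measurable_funM.
  by exists (M * N) => x; rewrite normrM ler_pM.
Qed.

Lemma indic_bounded_measurable (B : set X) : measurable B ->
  (\1_B : X -> R^o) \in @bounded_measurable d X R.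
Proof.
move=> mB; apply/asboolP; split; first exact: measurable_indic.
by exists 1 => x; rewrite indicE; case: (x \in B); rewrite /= ?normr1 ?normr0.
Qed.

Definition bmindic B (mB : measurable B) : bmfun X R := BMFun (indic_bounded_measurable mB).

Lemma l2ip_indic B C (mB : measurable B) (mC : measurable C) :
  l2ip (bmindic mB) (bmindic mC) = fine (mu (B `&` C)).
Proof.
rewrite /l2ip /Rintegral; congr fine.
rewrite -[B `&` C]setIT -integral_indic //; last exact: measurableI.
by apply: eq_integral => x _ /=; rewrite indicI.
Qed.

Lemma image_action v (B : set X) : T v @` B = T (- v) @^-1` B.
Proof.
case: actT => T0 TD _ _; apply/seteqP; split=> [_ [x Bx <-]|x Bx] /=.
  by rewrite -TD // addNr T0.
by exists (T (- v) x) => //; rewrite -TD // subrr T0.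
Qed.

Lemma koopman_indic_gt0 v B (mB : measurable B) :
  0 < l2ip (bmindic mB) (koopman v (bmindic mB)) -> (0 < mu (B `&` (T v @` B)))%E.
Proof.
have mTB : measurable (T (- v) @^-1` B) by rewrite -[X in measurable X]setTI; apply: mT.
have -> : koopman v (bmindic mB) = bmindic mTB.
  by apply: val_inj; apply/funext => x /=; rewrite !indicE.
rewrite l2ip_indic image_action => h.
rewrite lt0e measure_ge0 andbT; apply/negP => /eqP e; move: h.
by rewrite e ltxx.
Qed.

Lemma koopman_bmindicT v : koopman v (bmindic measurableT) = bmindic measurableT.
Proof. by apply: val_inj; apply/funext => x /=; rewrite !indicE !in_setT. Qed.

End KoopmanRepresentation.

(** * Conjugation orbits and characteristic polynomials *)

Section Traceless.
Variable n : nat.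

Definition traceless : {pred 'M[int]_n} := fun A => \tr A == 0.

Fact traceless_zmod_closed : zmod_closed traceless.
Proof.
split=> [|A B /eqP hA /eqP hB]; first by rewrite unfold_in mxtrace0.
by rewrite unfold_in linearB /= hA hB subrr.
Qed.

HB.instance Definition _ := GRing.isZmodClosed.Build 'M[int]_n traceless
  traceless_zmod_closed.

(** Traceless matrices as a group of their own, so that an action of the subset [sl n] becomes an
    action of a whole group. *)
Record slz := Slz { slval : 'M[int]_n; _ : slval \in traceless }.

HB.instance Definition _ := [isSub for slval].
HB.instance Definition _ := [Choice of slz by <:].
HB.instance Definition _ := [SubChoice_isSubZmodule of slz by <:].

Fact slval_zmod_morphism : zmod_morphism slval.
Proof. exact: (raddfB (\val : slz -> 'M[int]_n)). Qed.

HB.instance Definition _ := GRing.isZmodMorphism.Build slz 'M[int]_n slval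
  slval_zmod_morphism.

Lemma slval_trace (v : slz) : \tr (slval v) = 0.
Proof. by case: v => v hv; apply/eqP. Qed.

Definition toslz (A : 'M[int]_n) : slz := insubd (0 : slz) A.

Lemma toslzK A : \tr A = 0 -> slval (toslz A) = A.
Proof. by move=> /eqP hA; apply: (insubdK (0 : slz)). Qed.

End Traceless.

(** * Conjugates of companion matrices along quadratic walks *)

Lemma trace_conj_act n (g v : 'M[int]_n) : \det g = 1 -> \tr (conj_act g v) = \tr v.
Proof.
move=> dg; rewrite /conj_act mxtrace_mulC mulmxA mulVmx ?mul1mx //.
by rewrite unitmxE dg unitr1.
Qed.

Lemma conj_actD n (g u v : 'M[int]_n) : conj_act g (u + v) = conj_act g u + conj_act g v.
Proof. by rewrite /conj_act mulmxDr mulmxDl. Qed.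

Lemma conj_actN n (g v : 'M[int]_n) : conj_act g (- v) = - conj_act g v.
Proof. by rewrite /conj_act mulmxN mulNmx. Qed.

Lemma conj_actZ n (g v : 'M[int]_n) a : conj_act g (a *: v) = a *: conj_act g v.
Proof. by rewrite /conj_act -scalemxAr -scalemxAl. Qed.

(** The quadratic coefficient comes from [E v E = v_ji E] with [E = E_ij]; thus [v_ji = 1] makes it
    independent of [v]. *)
Lemma conj_act_transvection n (g v : 'M[int]_n) (i j : 'I_n) (x : nat) :
  \det g = 1 -> i != j -> v j i = 1 ->
  conj_act (g *m (1%:M + x%:R *: delta_mx i j)) v =
  conj_act g v + conj_act g (delta_mx i j *m v - v *m delta_mx i j) *+ x
    + (- conj_act g (delta_mx i j)) *+ (x ^ 2).
Proof.
move=> dg ij vji; have ug : g \in unitmx by rewrite unitmxE dg unitr1.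
have dt := det_transvection (x%:R : int) ij.
rewrite {1}/conj_act (@invmx_uniq _ _ _ ((1%:M - x%:R *: delta_mx i j) *m invmx g)); first last.
- rewrite mulmxA -[g *m _ *m _]mulmxA mulmxDl mul1mx mulmxBr mulmx1 -scalemxAl -scalemxAr.
  by rewrite mul_delta_mx_0 1?eq_sym // !scaler0 subr0 subrK mulmx1 mulmxV.
- by rewrite det_mulmx dg dt mulr1.
have -> : g *m (1%:M + x%:R *: delta_mx i j) *m v *m ((1%:M - x%:R *: delta_mx i j) *m invmx g)
    = conj_act g (tconj (i, j, x%:R) v).
  by rewrite /conj_act /tconj /= !mulmxA.
rewrite tconjE mul_delta_mx_delta vji scale1r.
move: (delta_mx i j *m v - v *m delta_mx i j) => c.
rewrite !conj_actD conj_actN !conj_actZ.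
by rewrite -natrX !scaler_nat mulNrn.
Qed.

Lemma companion_entry n p (i j : 'I_n) : (j : nat) != n.-1 -> i = j.+1 :> nat ->
  companion n p i j = 1.
Proof. by move=> jn ij; rewrite mxE (negPf jn) ij eqxx. Qed.

Lemma trace_companion n (p : {poly int}) : (0 < n)%N -> p`_n.-1 = 0 -> \tr (companion n p) = 0.
Proof.
move=> n0 pn; rewrite /mxtrace big1 // => i _; rewrite mxE.
case: eqP => [->|_]; first by rewrite pn oppr0.
by rewrite ltn_eqF.
Qed.

Lemma mp_action_slz (R : realType) n d (X : measurableType d) (mu : probability X R) T :
  mp_action (@sl n) mu T -> mp_action [set: slz n] mu (fun v => T (slval v)).
Proof.
case=> T0 TD mT iT; have slv (v : slz n) : sl (slval v) by apply: slval_trace.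
split=> [x|u v _ _ x|v _|v _ A mA]; [exact: T0 | | exact: mT | exact: iT].
by rewrite raddfD; apply: TD; apply: slv.
Qed.

(** [uniform_recurrence] is applied with [xi] the indicator of [B] and [e] the constant 1: [ip xi e]
    is the measure of [B], whence [b = eps ^+ 2]. With [j = n * n], any [2 ^ j] of the directions
    span. *)
Theorem companion_uvr_orbits (R : realType) n : (2 <= n)%N ->
  uvr_orbits R (@sl n) (@SL n) (@conj_act n) (@companion_set n).
Proof.
move=> n2 eps eps0.
have n0 : (0 < n)%N by apply: ltn_trans n2.
pose i0 := Ordinal n0; pose i1 := Ordinal (n2 : (1 < n)%N).
have i01 : i0 != i1 by [].
pose j := (n * n)%N; have hj : (n * n < 2 ^ j)%N by apply: ltn_expl.
have [m hm] := @uniform_recurrence R (slz n) (eps ^+ 2) j (exprn_gt0 2 eps0).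
have [gs [gsz dgs [L [L0 span]]]] := nilpotent_general_position i01 m hj.
pose E : 'M[int]_n := delta_mx i0 i1.
have trE : \tr E = 0.
  by rewrite /mxtrace big1 // => i _; rewrite mxE; case: eqP => // ->.
pose nil g : slz n := toslz (- conj_act g E).
have nilK g : \det g = 1 -> slval (nil g) = - conj_act g E.
  by move=> dg; rewrite toslzK // raddfN /= trace_conj_act // trE oppr0.
have [||k0 [k00 rec]] := hm [seq nil g | g <- gs] _ L L0.
- by rewrite size_map.
- move=> J sJ szJ u; have [t _ eJ] := subseqP sJ; rewrite -map_mask in eJ.
  set hs := mask t gs in eJ; pose K := [seq g *m E *m invmx g | g <- hs].
  have [||dd hdd] := span K _ _ (slval u) (slval_trace u).
  + by rewrite /K /hs map_mask mask_subseq.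
  + by rewrite /K size_map -szJ eJ size_map.
  exists (fun i => - dd i); apply: val_inj; rewrite raddfMn raddf_sum /= hdd.
  rewrite eJ /K !size_map; apply: eq_bigr => i _.
  have ihs : (i < size hs)%N by [].
  rewrite mulrNz raddfN raddfMz /= !(nth_map 0) // nilK; last first.
    by apply: dgs; apply: mem_mask; apply: mem_nth; apply: ihs.
  by rewrite mulNrz opprK.
exists k0; split=> // d X mu T /mp_action_slz actT B mB epsB.
have fmu A : measurable A -> mu A \is a fin_num by move=> mA; apply: fin_num_measure.
have [| | |k [kk0 hk]] := rec _ _ _ (koopman_unitary actT) (bmindic R mB)
    (bmindic R measurableT) _ (koopman_bmindicT actT).
- rewrite l2ip_indic setIid -lee_fin fineK ?fmu //; exact: probability_le1.
- by rewrite l2ip_indic setIid probability_setT.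
- rewrite l2ip_indic setIT ler_pXn2r ?nnegrE ?(ltW eps0) ?fine_ge0 //.
  by rewrite -lee_fin fineK ?fmu // ltW.
exists k; split=> // v [p [mp szp pn vE]].
(* [k] was fixed before [v]; here [O] is the conjugation orbit of [v]. *)
have [|o [[g [Sg og]] pos]] := hk (fun o => exists g, SL g /\ slval o = conj_act g v).
  move=> w /mapP[g ggs ->]; have dg := dgs g ggs.
  pose c := delta_mx i0 i1 *m v - v *m delta_mx i0 i1.
  exists (toslz (conj_act g v)), (toslz (conj_act g c)) => x.
  exists (g *m (1%:M + x%:R *: delta_mx i0 i1)); split.
    by rewrite /SL /= det_mulmx dg det_transvection.
  rewrite conj_act_transvection //; last first.
    (* Since [n >= 2], column 0 is not the last one, and its subdiagonal entry is 1. *)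
    by rewrite vE companion_entry //=; lia.
  rewrite !raddfD !raddfMn /= nilK //.
  rewrite !toslzK // trace_conj_act //.
    by rewrite /c raddfB /= mxtrace_mulC subrr.
  by rewrite vE trace_companion.
exists g; split=> //; have := koopman_indic_gt0 pos.
by rewrite -og -raddfMn.
Qed.

(** * Characteristic polynomials *)

Lemma char_poly_tr (R : comNzRingType) n (A : 'M[R]_n) : char_poly A^T = char_poly A.
Proof.
rewrite /char_poly -det_tr; congr (\det _).
by rewrite /char_poly_mx linearB /= tr_scalar_mx map_trmx trmxK.
Qed.

Lemma char_poly_companion (n : nat) (p : {poly int}) :
  p \is monic -> size p = n.+1 -> char_poly (companion n p) = p.
Proof.
move=> mp szp; have {szp} : n = (size p).-1 by rewrite szp.
(* [companionmx] is the transpose of [companion]. *)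
move=> ->; rewrite -[RHS](companionmxK mp) -char_poly_tr; congr (char_poly _).
by apply/matrixP => i j; rewrite !mxE [j.+1 == _]eq_sym.
Qed.

Lemma char_poly_conj_act n (g A : 'M[int]_n) : \det g = 1 ->
  char_poly (conj_act g A) = char_poly A.
Proof.
move=> dg; have ug : g \in unitmx by rewrite unitmxE dg unitr1.
rewrite /char_poly.
have -> : char_poly_mx (conj_act g A) =
    map_mx polyC g *m char_poly_mx A *m map_mx polyC (invmx g).
  rewrite /char_poly_mx /conj_act mulmxBr mulmxBl -!map_mxM; congr (_ - _).
  by rewrite scalar_mxC -mulmxA -map_mxM mulmxV // map_mx1 mulmx1.
by rewrite !det_mulmx !det_map_mx det_inv dg invr1 mul1r mulr1.
Qed.

(** Substituting [k X] in the characteristic polynomial of [k C] gives [k^n] times that of [C], and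
    this substitution is injective. *)
Lemma char_poly_mulrn n (A B : 'M[int]_n) k : (0 < k)%N ->
  char_poly A = char_poly B -> char_poly (A *+ k) = char_poly (B *+ k).
Proof.
move=> k0 AB; have q2 : (1 < size (k%:R *: 'X : {poly int}))%N.
  by rewrite size_scale ?size_polyX // pnatr_eq0 -lt0n.
have E (C : 'M[int]_n) : char_poly (C *+ k) \Po (k%:R *: 'X) = k%:R ^+ n *: char_poly C.
  have -> : k%:R ^+ n *: char_poly C = (k%:R%:P) ^+ n * char_poly C.
    by rewrite -polyC_exp mul_polyC.
  rewrite /char_poly -detZ -[LHS]/(comp_poly _ _) -det_map_mx -scaler_nat; congr (\det _).
  apply/matrixP => i j; rewrite !mxE /= comp_polyB comp_polyC raddfMn /= comp_polyX.
  by rewrite polyCM mulrBr mulrnAr !mul_polyC.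
by apply/eqP; rewrite -subr_eq0 -(comp_poly_eq0 _ q2) comp_polyB !E AB subrr.
Qed.

(** The [k] for orbits depends on the action and on [B], but divides [k0!]. Write [w k0! = w' k] and
    replace [w'] by the companion matrix of its characteristic polynomial, some conjugate of which
    returns after scaling by [k]. *)
Theorem char_poly_uvr_level_sets (R : realType) n : (2 <= n)%N ->
  uvr_level_sets R (@sl n) (fun A : 'M[int]_n => char_poly A).
Proof.
move=> n2 eps eps0; have [k0 [k00 rec]] := companion_uvr_orbits n2 eps0.
have n0 : (0 < n)%N by apply: ltn_trans n2.
exists k0`!; split=> [|d X mu T actT B mB epsB w Sw]; first exact: fact_gt0.
have [k [/andP[k1 kk0] hk]] := rec d X mu T actT B mB epsB.
pose w' := w *+ (k0`! %/ k); pose p := char_poly w'.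
have trw' : \tr w' = 0 by rewrite /w' raddfMn /= Sw mul0rn.
have szp : size p = n.+1 by rewrite size_char_poly.
have mp : p \is monic by apply: char_poly_monic.
have pn : p`_n.-1 = 0 by rewrite char_poly_trace // trw' oppr0.
have [|g [Sg pos]] := hk (companion n p); first by exists p.
exists (conj_act g (companion n p) *+ k); split; last split=> //.
  by rewrite /sl /= raddfMn /= trace_conj_act // trace_companion // mul0rn.
have -> : w *+ k0`! = w' *+ k by rewrite /w' -mulrnA divnK // dvdn_fact // k1.
by apply: char_poly_mulrn; rewrite // char_poly_conj_act // char_poly_companion.
Qed.

(** * The quadratic form as the determinant on sl_2 *)

Definition sl2_of_row (v : 'rV[int]_3) : 'M[int]_2 := \matrix_(i, j)
  if i == 0 then (if j == 0 then v ord0 (@Ordinal 3 2 isT) else v ord0 (@Ordinal 3 0 isT))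
  else (if j == 0 then - v ord0 (@Ordinal 3 1 isT) else - v ord0 (@Ordinal 3 2 isT)).

Definition row_of_sl2 (A : 'M[int]_2) : 'rV[int]_3 := \row_i
  if i == 0 :> nat then A 0 1 else if i == 1 :> nat then - A 1 0 else A 0 0.

(** The row [(x, y, z)] corresponds to the traceless matrix with rows [(z, x)] and [(-y, -z)], of
    determinant [x y - z^2]. *)
Lemma quadF_row_of_sl2 A : \tr A = 0 -> quadF (row_of_sl2 A) = \det A.
Proof.
have e1 : lift ord0 ord0 = 1 :> 'I_2 by apply: val_inj.
have e2 : lift 1 0 = 0 :> 'I_2 by apply: val_inj.
rewrite /mxtrace !big_ord_recl big_ord0 addr0 e1 => trA.
have {}trA : A 1 1 = - A 0 0 by apply/eqP; rewrite -addr_eq0 addrC; apply/eqP.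
rewrite (expand_det_row _ 0) !big_ord_recl big_ord0 /cofactor !det_mx11.
rewrite /quadF !mxE /= e1 e2 trA /bump /= expr0 expr1; ring.
Qed.

Theorem quadF_uvr_level_sets (R : realType) : uvr_level_sets R [set: 'rV[int]_3] quadF.
Proof.
move=> eps eps0; have [k [k1 rec]] := char_poly_uvr_level_sets (leqnn 2) eps0.
exists k; split=> // d X mu T [T0 TD mT iT] B mB epsB w _.
have rowD u v : row_of_sl2 (u + v) = row_of_sl2 u + row_of_sl2 v.
  by apply/rowP => i; rewrite !mxE; do 2?case: ifP => // _; rewrite opprD.
have row0 : row_of_sl2 0 = 0 by apply: (addrI (row_of_sl2 0)); rewrite -rowD !addr0.
have Sw : \tr (sl2_of_row w) = 0.
  by rewrite /mxtrace !big_ord_recl big_ord0 !mxE /= addr0 subrr.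
have sl2K v : row_of_sl2 (sl2_of_row v) = v.
  apply/rowP => i; rewrite !mxE /= opprK.
  by case: i => [[|[|[|//]]] hi] /=; congr (v _ _); apply: val_inj.
have [||v [Sv [Fv pos]]] := rec d X mu (fun A => T (row_of_sl2 A)) _ B mB epsB (sl2_of_row w).
- split=> [x|u v _ _ x|v _|v _ A mA]; [|rewrite rowD; exact: TD|exact: mT|exact: iT].
  by rewrite row0 T0.
- exact: Sw.
have rowMn A m : row_of_sl2 (A *+ m) = row_of_sl2 A *+ m.
  by elim: m => [|m IH]; rewrite ?mulr0n // !mulrS rowD IH.
exists (row_of_sl2 v); split=> //; split=> //.
rewrite -[w in RHS]sl2K -rowMn !quadF_row_of_sl2 //; last first.
  by rewrite raddfMn /= Sw mul0rn.
(* In size 2 the constant coefficient of the characteristic polynomial is the determinant. *)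
have := congr1 (fun p : {poly int} => p`_0) Fv.
by rewrite !char_poly_det sqrrN expr1n !mul1r.
Qed.

Theorem theoremA (R : realType) (n : nat) : (2 <= n)%N ->
  [/\ uvr_orbits R (@sl n) (@SL n) (@conj_act n) (@companion_set n),
      uvr_level_sets R (@sl n) (fun A : 'M[int]_n => char_poly A) &
      uvr_level_sets R [set: 'rV[int]_3] quadF].
Proof.
move=> n2; split; first exact: companion_uvr_orbits.
  exact: char_poly_uvr_level_sets.
exact: quadF_uvr_level_sets.
Qed.
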